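(* Let $k$ be a field of characteristic $0$, $R$ a Hopf $k$-algebra, and $A=A(R,X_+,X_-,\sigma,h,\xi)$ an ambiskew algebra with a Hopf algebra structure extending that of $R$, such that $\Delta(X_{\pm})=X_{\pm}\otimes 1+y_{\pm}\otimes X_{\pm}$ with $y_{\pm}\in G(R)$. Let $\{R_a:a\ge0\}$ and $\{A_t:t\geq 0\}$ be the coradical filtrations of $R$ and $A$ respectively. Then for all $t\geq 0$, $$A_t = \sum_{q+\widehat{m}+\widehat{n}\leq t} R_q\, X_+^m X_-^n ,$$ where the sum is over non-negative integers $q,m,n$ with $q+\widehat{m}+\widehat{n}\le t$.
   Context: Hopf algebras have bijective antipode. Given a $k$-algebra $R$, a $k$-algebra automorphism $\sigma$ of $R$, a central element $h\in R$, and a nonzero $\xi\in k$, the ambiskew algebra $A(R,X_+,X_-,\sigma,h,\xi)$ is the $k$-algebra generated by $R$ and $X_+,X_-$ subject to $X_+r=\sigma(r)X_+$, $X_-r=\sigma^{-1}(r)X_-$ ($r\in R$), $X_+X_-=h+\xi X_-X_+$. $G(R)$ is the group of grouplike elements. The coradical filtration $\{C_n:n\ge0\}$ of a coalgebra $C$: $C_0$ is the sum of the simple subcoalgebras, and $C_{n+1}=\{c\in C:\Delta(c)\in C_n\otimes C+C\otimes C_0\}$. The notation $\widehat{m}$ depends on $\xi$: if $\xi$ is a primitive $d$th root of unity with $d>1$, write $m=dq_m+r_m$ with $q_m\geq0$ and $0\leq r_m<d$; if $\xi=1$ or $\xi$ is not a root of unity, put $q_m:=m$, $r_m:=0$. Then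 $\widehat{m}:=q_m+r_m$. *)

(* Defs.v *)
From HB Require Import structures.
From mathcomp Require Import all_boot all_order all_algebra generic_quotient.
From mathcomp Require Import boolp classical_sets.

Set Implicit Arguments.
Unset Strict Implicit.
Unset Printing Implicit Defensive.

Import GRing.Theory.
Local Open Scope ring_scope.
Local Open Scope quotient_scope.

Reserved Notation "u \ox v" (at level 40, left associativity).

(* V (x) W is the type of formal sums v_1 (x) w_1 + ... + v_n (x) w_n, written *)
(* as lists of pairs, modulo the congruence generated by commutativity of the  *)
(* sum and bilinearity of the pairs. The universal property is tlift_bilinear  *)
(* and tlift_unique below.                                                     *)
Section Tensor.
Variables (k : fieldType) (V W : lmodType k).
Implicit Types (s t : seq (V * W)).

Inductive tensor_eq : seq (V * W) -> seq (V * W) -> Prop :=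
| tensor_eq_refl s : tensor_eq s s
| tensor_eq_sym s t : tensor_eq s t -> tensor_eq t s
| tensor_eq_trans s t u : tensor_eq s t -> tensor_eq t u -> tensor_eq s u
| tensor_eq_cat s s' t t' :
    tensor_eq s s' -> tensor_eq t t' -> tensor_eq (s ++ t) (s' ++ t')
| tensor_eq_catC s t : tensor_eq (s ++ t) (t ++ s)
| tensor_eq_0 w : tensor_eq [:: (0, w)] [::]
| tensor_eq_Dl v v' w : tensor_eq [:: (v + v', w)] [:: (v, w); (v', w)]
| tensor_eq_Dr v w w' : tensor_eq [:: (v, w + w')] [:: (v, w); (v, w')]
| tensor_eq_Z a v w : tensor_eq [:: (a *: v, w)] [:: (v, a *: w)].

Definition tensor_eqb s t : bool := `[< tensor_eq s t >].

Lemma tensor_eqb_refl : reflexive tensor_eqb.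
Proof. by move=> s; apply/asboolP; exact: tensor_eq_refl. Qed.

Lemma tensor_eqb_sym : symmetric tensor_eqb.
Proof. by move=> s t; apply/asboolP/asboolP; exact: tensor_eq_sym. Qed.

Lemma tensor_eqb_trans : transitive tensor_eqb.
Proof.
move=> t s u /asboolP st /asboolP tu; apply/asboolP.
exact: tensor_eq_trans st tu.
Qed.

Canonical tensor_equiv :=
  EquivRel tensor_eqb tensor_eqb_refl tensor_eqb_sym tensor_eqb_trans.

Definition tensor := {eq_quot tensor_equiv}.
HB.instance Definition _ := Choice.on tensor.
HB.instance Definition _ : EqQuotient _ tensor_equiv tensor :=
  EqQuotient.on tensor.

Definition tensor_of s : tensor := \pi_tensor s.

Lemma tensor_ofP s t : tensor_eq s t <-> tensor_of s = tensor_of t.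
Proof.
split=> [st|/eqmodP st]; first by apply/eqmodP/asboolP.
by apply/asboolP.
Qed.

Lemma tensor_of_repr (x : tensor) : tensor_of (repr x) = x.
Proof. exact: reprK. Qed.

Lemma repr_tensor_of s : tensor_eq (repr (tensor_of s)) s.
Proof. by apply/tensor_ofP; rewrite tensor_of_repr. Qed.

Definition scale_rep a s : seq (V * W) := [seq (a *: p.1, p.2) | p <- s].

Definition tensor_add (x y : tensor) : tensor := tensor_of (repr x ++ repr y).
Definition tensor_scale a (x : tensor) : tensor :=
  tensor_of (scale_rep a (repr x)).
Definition tensor_zero : tensor := tensor_of [::].
Definition tensor_opp (x : tensor) : tensor := tensor_scale (-1) x.

Lemma tensor_addE s t :
  tensor_add (tensor_of s) (tensor_of t) = tensor_of (s ++ t).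
Proof. by apply/tensor_ofP/tensor_eq_cat; exact: repr_tensor_of. Qed.

Lemma scale_rep_eq a s t :
  tensor_eq s t -> tensor_eq (scale_rep a s) (scale_rep a t).
Proof.
elim=> {s t} /=.
- by move=> s; exact: tensor_eq_refl.
- by move=> s t _; exact: tensor_eq_sym.
- by move=> s t u _ st _; exact: tensor_eq_trans st.
- by move=> s s' t t' _ ss' _ tt'; rewrite /scale_rep !map_cat;
    exact: tensor_eq_cat.
- by move=> s t; rewrite /scale_rep !map_cat; exact: tensor_eq_catC.
- by move=> w; rewrite scaler0; exact: tensor_eq_0.
- by move=> v v' w; rewrite scalerDr; exact: tensor_eq_Dl.
- by move=> v w w'; exact: tensor_eq_Dr.
- by move=> b v w; rewrite scalerA mulrC -scalerA; exact: tensor_eq_Z.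
Qed.

Lemma tensor_scaleE a s :
  tensor_scale a (tensor_of s) = tensor_of (scale_rep a s).
Proof. by apply/tensor_ofP/scale_rep_eq; exact: repr_tensor_of. Qed.

Lemma tensorW (P : tensor -> Prop) :
  (forall s, P (tensor_of s)) -> forall x, P x.
Proof. by move=> Ps x; rewrite -(tensor_of_repr x). Qed.

Lemma tensor_addA : associative tensor_add.
Proof.
by elim/tensorW=> s; elim/tensorW=> t; elim/tensorW=> u; rewrite !tensor_addE catA.
Qed.

Lemma tensor_addC : commutative tensor_add.
Proof.
elim/tensorW=> s; elim/tensorW=> t; rewrite !tensor_addE.
by apply/tensor_ofP/tensor_eq_catC.
Qed.

Lemma tensor_add0 : left_id tensor_zero tensor_add.
Proof. by elim/tensorW=> s; rewrite tensor_addE. Qed.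

Lemma tensor_scaleDl x a b :
  tensor_scale (a + b) x = tensor_add (tensor_scale a x) (tensor_scale b x).
Proof.
elim/tensorW: x => s; rewrite !tensor_scaleE tensor_addE; apply/tensor_ofP.
elim: s => [|[v w] s IHs]; first exact: tensor_eq_refl.
rewrite /= -[_ :: _]cat1s scalerDl.
apply: tensor_eq_trans (tensor_eq_cat (tensor_eq_Dl _ _ _) IHs) _ => /=.
rewrite -[_ :: _ :: _]cat1s -[X in tensor_eq _ X]cat1s.
apply: tensor_eq_cat (tensor_eq_refl _) _.
rewrite -cat1s -[(_, w) :: scale_rep b s]cat1s !catA.
exact: tensor_eq_cat (tensor_eq_catC _ _) (tensor_eq_refl _).
Qed.

Lemma tensor_scale0 x : tensor_scale 0 x = tensor_zero.
Proof.
elim/tensorW: x => s; rewrite tensor_scaleE; apply/tensor_ofP.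
elim: s => [|[v w] s IHs]; first exact: tensor_eq_refl.
by rewrite /= scale0r -cat1s; exact: tensor_eq_cat (tensor_eq_0 _) IHs.
Qed.

Lemma tensor_scaleA a b x :
  tensor_scale a (tensor_scale b x) = tensor_scale (a * b) x.
Proof.
elim/tensorW: x => s; rewrite !tensor_scaleE /scale_rep -map_comp.
by congr tensor_of; apply: eq_map => -[v w] /=; rewrite scalerA.
Qed.

Lemma tensor_scale1 : left_id 1 tensor_scale.
Proof.
elim/tensorW=> s; rewrite tensor_scaleE /scale_rep -[in RHS](map_id s).
by congr tensor_of; apply: eq_map => -[v w] /=; rewrite scale1r.
Qed.

Lemma tensor_scaleDr a x y :
  tensor_scale a (tensor_add x y)
  = tensor_add (tensor_scale a x) (tensor_scale a y).
Proof.
elim/tensorW: x => s; elim/tensorW: y => t.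
by rewrite !(tensor_scaleE, tensor_addE) /scale_rep map_cat.
Qed.

Lemma tensor_addN : left_inverse tensor_zero tensor_opp tensor_add.
Proof.
move=> x; rewrite -[X in tensor_add _ X]tensor_scale1 -tensor_scaleDl addNr.
exact: tensor_scale0.
Qed.

HB.instance Definition _ := GRing.isZmodule.Build tensor
  tensor_addA tensor_addC tensor_add0 tensor_addN.
HB.instance Definition _ := GRing.Zmodule_isLmodule.Build k tensor
  tensor_scaleA tensor_scale1 tensor_scaleDr (fun x a b => tensor_scaleDl x a b).

Definition tens (v : V) (w : W) : tensor := tensor_of [:: (v, w)].

Local Notation "u \ox v" := (tens u v).

Lemma tensDl v v' w : (v + v') \ox w = v \ox w + v' \ox w.
Proof. by rewrite [RHS]tensor_addE; apply/tensor_ofP/tensor_eq_Dl. Qed.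

Lemma tensDr v w w' : v \ox (w + w') = v \ox w + v \ox w'.
Proof. by rewrite [RHS]tensor_addE; apply/tensor_ofP/tensor_eq_Dr. Qed.

Lemma tensZl a v w : (a *: v) \ox w = a *: (v \ox w).
Proof. by rewrite [RHS]tensor_scaleE. Qed.

Lemma tensZr a v w : v \ox (a *: w) = a *: (v \ox w).
Proof. by rewrite -tensZl; apply/esym/tensor_ofP/tensor_eq_Z. Qed.

Lemma tens_is_bilinear : bilinear_for *:%R *:%R tens.
Proof.
by split=> [w a u v|v a u w] /=; rewrite (tensDl, tensDr) (tensZl, tensZr).
Qed.

Lemma tensor_of_sum s : tensor_of s = \sum_(p <- s) p.1 \ox p.2.
Proof.
elim: s => [|[v w] s IHs]; first by rewrite big_nil.
by rewrite big_cons -IHs [RHS]tensor_addE.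
Qed.

Lemma tensor_sum (x : tensor) : x = \sum_(p <- repr x) p.1 \ox p.2.
Proof. by rewrite -tensor_of_sum tensor_of_repr. Qed.

Lemma tensor_ind (P : tensor -> Prop) :
  P 0 -> (forall v w x, P x -> P (v \ox w + x)) -> forall x, P x.
Proof.
move=> P0 PD x; rewrite (tensor_sum x).
by elim: (repr x) => [|p s IHs]; rewrite ?big_nil // big_cons; exact: PD.
Qed.

(* The linear map v \ox w |-> f v w; only meaningful for bilinear f. *)
Definition tlift (U : lmodType k) (f : V -> W -> U) (x : tensor) : U :=
  \sum_(p <- repr x) f p.1 p.2.

Section Lift.
Variables (U : lmodType k) (f : V -> W -> U).
Hypothesis fP : bilinear_for *:%R *:%R f.

Let f0 w : f 0 w = 0.
Proof. by have := fP.1 w (-1) 0 0; rewrite /= !scaler0 addr0 scaleN1r addNr. Qed.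

Let fDl v v' w : f (v + v') w = f v w + f v' w.
Proof. by have := fP.1 w 1 v v'; rewrite /= !scale1r. Qed.

Let fDr v w w' : f v (w + w') = f v w + f v w'.
Proof. by have := fP.2 v 1 w w'; rewrite /= !scale1r. Qed.

Let f0r v : f v 0 = 0.
Proof. by have := fP.2 v (-1) 0 0; rewrite /= !scaler0 addr0 scaleN1r addNr. Qed.

Let fZl a v w : f (a *: v) w = a *: f v w.
Proof. by have := fP.1 w a v 0; rewrite /= !addr0 f0 addr0. Qed.

Let fZr a v w : f v (a *: w) = a *: f v w.
Proof. by have := fP.2 v a w 0; rewrite /= !addr0 f0r addr0. Qed.

Lemma tlift_of s : tlift f (tensor_of s) = \sum_(p <- s) f p.1 p.2.
Proof.
rewrite /tlift; move: (repr _) (repr_tensor_of s) => t.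
elim=> {s t} //=.
- by move=> s t u _ -> _ ->.
- by move=> s s' t t' _ es _ et; rewrite !big_cat /= es et.
- by move=> s t; rewrite !big_cat /= addrC.
- by move=> w; rewrite big_seq1 big_nil f0.
- by move=> v v' w; rewrite !big_cons !big_nil !addr0 fDl.
- by move=> v w w'; rewrite !big_cons !big_nil !addr0 fDr.
- by move=> a v w; rewrite !big_seq1 /= fZl fZr.
Qed.

Lemma tlift_tens v w : tlift f (v \ox w) = f v w.
Proof. by rewrite tlift_of big_seq1. Qed.

Lemma tlift_linear : linear (tlift f).
Proof.
move=> a; elim/tensorW=> s; elim/tensorW=> t.
have -> : a *: tensor_of s + tensor_of t = tensor_of (scale_rep a s ++ t).
  by rewrite [a *: _]tensor_scaleE [LHS]tensor_addE.
rewrite !tlift_of big_cat /= big_map scaler_sumr; congr (_ + _).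
by apply: eq_bigr => p _ /=; rewrite fZl.
Qed.

Lemma tlift_bilinear : linear (tlift f) /\ (forall v w, tlift f (v \ox w) = f v w).
Proof. by split; [exact: tlift_linear | exact: tlift_tens]. Qed.

End Lift.

Lemma tensor_ext (U : lmodType k) (g g' : tensor -> U) :
  linear g -> linear g' -> (forall v w, g (v \ox w) = g' (v \ox w)) -> g =1 g'.
Proof.
move=> gP g'P eg x.
pose G : {linear tensor -> U} := HB.pack g (GRing.isLinear.Build k tensor U _ g gP).
pose G' : {linear tensor -> U} :=
  HB.pack g' (GRing.isLinear.Build k tensor U _ g' g'P).
rewrite (tensor_sum x) -[g]/(G : _ -> _) -[g']/(G' : _ -> _) !linear_sum.
by apply: eq_bigr => p _; exact: eg.
Qed.

Lemma tlift_unique (U : lmodType k) (f : V -> W -> U) (g : tensor -> U) :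
  bilinear_for *:%R *:%R f ->
  linear g -> (forall v w, g (v \ox w) = f v w) -> g =1 tlift f.
Proof.
move=> fP gP gf; apply: tensor_ext gP (tlift_linear fP) _ => v w.
by rewrite gf tlift_tens.
Qed.

End Tensor.

Notation "u \ox v" := (tens u v) : ring_scope.

Definition tmap (k : fieldType) (V V' W W' : lmodType k)
    (f : V -> V') (g : W -> W') : tensor V W -> tensor V' W' :=
  tlift (fun v w => f v \ox g w).

Definition tassoc (k : fieldType) (U V W : lmodType k) :
    tensor (tensor U V) W -> tensor U (tensor V W) :=
  tlift (fun x w => tlift (fun u v => u \ox (v \ox w)) x).

Section TensorRing.
Variables (k : fieldType) (A B : algType k).
Local Notation AB := (tensor A B).

Definition tensor_one : AB := 1 \ox 1.
Definition tensor_mul (x y : AB) : AB :=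
  tlift (fun a b => tlift (fun c d => (a * c) \ox (b * d)) y) x.

Let bil_in a b :
  bilinear_for *:%R *:%R (fun c d => (a * c) \ox (b * d) : AB).
Proof.
split=> [d e c c'|c e d d'] /=.
  by rewrite mulrDr tensDl -scalerAr tensZl.
by rewrite mulrDr tensDr -scalerAr tensZr.
Qed.

Let bil_out y :
  bilinear_for *:%R *:%R
    (fun a b => tlift (fun c d => (a * c) \ox (b * d) : AB) y).
Proof.
split=> [b e a a'|a e b b'] /=.
  rewrite (tensor_sum y) -tensor_of_sum !tlift_of //.
  rewrite scaler_sumr -big_split /=; apply: eq_bigr => p _.
  by rewrite mulrDl tensDl -scalerAl tensZl.
rewrite (tensor_sum y) -tensor_of_sum !tlift_of //.
rewrite scaler_sumr -big_split /=; apply: eq_bigr => p _.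
by rewrite mulrDl tensDr -scalerAl tensZr.
Qed.

Lemma tensor_mul_tens a b c d :
  tensor_mul (a \ox b) (c \ox d) = (a * c) \ox (b * d).
Proof. by rewrite /tensor_mul !tlift_tens. Qed.

Lemma tensor_mul_linl y : linear (tensor_mul^~ y).
Proof. exact: tlift_linear. Qed.

Lemma tensor_mul_linr x : linear (tensor_mul x).
Proof.
move=> e y y'; rewrite /tensor_mul (tensor_sum x) -tensor_of_sum !tlift_of //.
rewrite scaler_sumr -big_split /=; apply: eq_bigr => p _.
by rewrite tlift_linear.
Qed.

Let mull (y : AB) : {linear AB -> AB} :=
  HB.pack (tensor_mul^~ y) (GRing.isLinear.Build k AB AB _ _ (tensor_mul_linl y)).
Let mulr (x : AB) : {linear AB -> AB} :=
  HB.pack (tensor_mul x) (GRing.isLinear.Build k AB AB _ _ (tensor_mul_linr x)).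

Let tensor_mulDl : left_distributive tensor_mul +%R.
Proof. by move=> x y z; exact: (linearD (mull z)). Qed.

Let tensor_mulDr : right_distributive tensor_mul +%R.
Proof. by move=> x y z; exact: (linearD (mulr x)). Qed.

Let tensor_mul0l y : tensor_mul 0 y = 0.
Proof. exact: (linear0 (mull y)). Qed.

Let tensor_mul0r x : tensor_mul x 0 = 0.
Proof. exact: (linear0 (mulr x)). Qed.

Lemma tensor_mulA : associative tensor_mul.
Proof.
move=> x y z; elim/tensor_ind: x => [|a b x IHx]; first by rewrite !tensor_mul0l.
rewrite !tensor_mulDl {}IHx; congr (_ + _).
elim/tensor_ind: y => [|c d y IHy].
  by rewrite tensor_mul0r !tensor_mul0l tensor_mul0r.
rewrite tensor_mulDl !tensor_mulDr tensor_mulDl {}IHy; congr (_ + _).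
elim/tensor_ind: z => [|e f z IHz]; first by rewrite !tensor_mul0r.
by rewrite !tensor_mulDr {}IHz !tensor_mul_tens !mulrA.
Qed.

Lemma tensor_mul1 : left_id tensor_one tensor_mul.
Proof.
elim/tensor_ind=> [|a b x IHx]; first by rewrite tensor_mul0r.
by rewrite tensor_mulDr {}IHx tensor_mul_tens !mul1r.
Qed.

Lemma tensor_mulr1 : right_id tensor_one tensor_mul.
Proof.
elim/tensor_ind=> [|a b x IHx]; first by rewrite tensor_mul0l.
by rewrite tensor_mulDl {}IHx tensor_mul_tens !mulr1.
Qed.

HB.instance Definition _ := GRing.Zmodule_isPzRing.Build AB
  tensor_mulA tensor_mul1 tensor_mulr1 tensor_mulDl tensor_mulDr.

Lemma tensM (a c : A) (b d : B) :
  (a \ox b) * (c \ox d) = (a * c) \ox (b * d) :> AB.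
Proof. exact: tensor_mul_tens. Qed.

End TensorRing.

HB.mixin Record Lmodule_isCoalgebra (k : fieldType) C of GRing.Lmodule k C := {
  comul : {linear C -> tensor C C};
  counit : {scalar C};
  comulA : forall c : C,
    tassoc (tmap comul idfun (comul c)) = tmap idfun comul (comul c);
  counitl : forall c : C, tlift (fun a b => counit a *: b) (comul c) = c;
  counitr : forall c : C, tlift (fun a b => counit b *: a) (comul c) = c
}.

#[short(type="coalgType")]
HB.structure Definition Coalgebra (k : fieldType) :=
  {C of GRing.Lmodule k C & Lmodule_isCoalgebra k C}.

HB.mixin Record Algebra_isHopfAlgebra (k : fieldType) A
    of GRing.Algebra k A & Coalgebra k A := {
  comul_monoid_morphism : monoid_morphism (comul : A -> tensor A A);
  counit_monoid_morphism : monoid_morphism (counit : A -> k);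
  antipode : {linear A -> A};
  antipodel : forall a : A,
    tlift (fun b c => antipode b * c) (comul a) = (counit a)%:A;
  antipoder : forall a : A,
    tlift (fun b c => b * antipode c) (comul a) = (counit a)%:A;
  antipode_bij : bijective antipode
}.

#[short(type="hopfAlgType")]
HB.structure Definition HopfAlgebra (k : fieldType) :=
  {A of GRing.Algebra k A & Coalgebra k A & Algebra_isHopfAlgebra k A}.

Local Open Scope classical_set_scope.

Section Subspaces.
Variables (k : fieldType).

Definition subspace (V : lmodType k) (D : set V) : Prop :=
  D 0 /\ forall (a : k) (u v : V), D u -> D v -> D (a *: u + v).

Definition lspan (V : lmodType k) (S : set V) : set V := smallest (@subspace V) S.

Definition add_subspace (V : lmodType k) (D E : set V) : set V :=
  [set u + v | u in D & v in E].

(* The image of D (x) E in V (x) W. *)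
Definition tensor_subspace (V W : lmodType k) (D : set V) (E : set W) :
    set (tensor V W) :=
  lspan [set v \ox w | v in D & w in E].

End Subspaces.

Section CoradicalFiltration.
Variables (k : fieldType) (C : coalgType k).

Definition subcoalgebra (D : set C) : Prop :=
  subspace D /\ forall c, D c -> tensor_subspace D D (comul c).

Definition simple_subcoalgebra (D : set C) : Prop :=
  [/\ subcoalgebra D, D <> [set 0] &
      forall E, subcoalgebra E -> E `<=` D -> E = [set 0] \/ E = D].

Definition coradical : set C :=
  lspan (\bigcup_(D in [set D | simple_subcoalgebra D]) D).

Fixpoint coradical_filtration (n : nat) : set C :=
  if n is n'.+1 then
    [set c | add_subspace (tensor_subspace (coradical_filtration n') setT)
                          (tensor_subspace setT coradical) (comul c)]
  else coradical.

End CoradicalFiltration.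

Arguments coradical {k} C _.
Arguments coradical_filtration {k} C n _.

Section Hopf.
Variables (k : fieldType).

Definition grouplike (C : coalgType k) (g : C) : Prop :=
  comul g = g \ox g /\ counit g = 1.

Definition hopf_extension (R A : hopfAlgType k) (i : R -> A) : Prop :=
  [/\ forall r, comul (i r) = tmap i i (comul r),
      forall r, counit (i r) = counit r
    & forall r, antipode (i r) = i (antipode r)].

End Hopf.

Section Ambiskew.
Variables (k : fieldType) (R : algType k).
Variables (sigma sigmaV : R -> R) (h : R) (xi : k).

Definition ambiskew_relations (B : algType k) (f : R -> B) (xp xm : B) : Prop :=
  [/\ forall r, xp * f r = f (sigma r) * xp,
      forall r, xm * f r = f (sigmaV r) * xm
    & xp * xm = f h + xi *: (xm * xp)].

(* (A, i, Xp, Xm) is the algebra generated by R and Xp, Xm subject to the      *)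
(* ambiskew relations, expressed as the universal property of a presentation;  *)
(* i is the structure map R -> A.                                              *)
Definition is_ambiskew (A : algType k) (i : {lrmorphism R -> A}) (Xp Xm : A) :
    Prop :=
  ambiskew_relations i Xp Xm /\
  forall (B : algType k) (f : {lrmorphism R -> B}) (xp xm : B),
    ambiskew_relations f xp xm ->
    exists g : {lrmorphism A -> B},
      [/\ g \o i =1 f, g Xp = xp & g Xm = xm] /\
      forall g' : {lrmorphism A -> B},
        [/\ g' \o i =1 f, g' Xp = xp & g' Xm = xm] -> g' =1 g.

End Ambiskew.

(* The d > 1 such that xi is a primitive d-th root of unity, if any, and 1 if  *)
(* xi = 1 or xi is not a root of unity; m %/ 1 = m and m %% 1 = 0.             *)
Definition hat_order (k : fieldType) (xi : k) : nat :=
  xget 1%N [set d | (1 < d)%N && d.-primitive_root xi].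

Definition hat (k : fieldType) (xi : k) (m : nat) : nat :=
  (m %/ hat_order xi + m %% hat_order xi)%N.

(* Main.v *)
(* Write g.c = c_1 g(c_2) for a functional g. Then c lies in C_(n+1) iff g.c   *)
(* lies in C_n for every g vanishing on C_0, so the coradical filtration is    *)
(* governed by the module structure of C over its dual algebra. By the PBW     *)
(* theorem A is free over R on the X+^m X-^n; applying Delta to the relation   *)
(* for X+ X- gives sigma(y+-) = xi y+-, so Delta(X+-^m) is a q-binomial sum,   *)
(* and the X+^m X-^n coordinate of (f o pi_jl).x is, up to a grouplike, f.r    *)
(* times q-binomials in (m+j, j) and (n+l, l), with r the coordinate of x at   *)
(* (m+j, n+l). Taking (j, l) maximal with r nonzero shows that every nonzero   *)
(* subcoalgebra of A meets R, so A_0 = R_0. The theorem then follows by        *)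
(* induction on t: the q-Lucas theorem says that a q-binomial (m, j) with j > 0 *)
(* is nonzero only if passing from m to m - j lowers the hat, and in           *)
(* characteristic 0 some j lowers it by exactly 1.                             *)

Require Import Defs.
From HB Require Import structures.
From mathcomp Require Import all_boot all_order all_algebra.
From mathcomp Require Import boolp classical_sets functions.
From mathcomp Require Import ring zify.

Set Implicit Arguments.
Unset Strict Implicit.
Unset Printing Implicit Defensive.

Import GRing.Theory.
Local Open Scope ring_scope.
Local Open Scope classical_set_scope.

(** A tensor is controlled by its contractions with functionals ([contractr_add_subspaceP],
    [tensor_subspaceP]). Hence subcoalgebras are the subspaces stable under both actions [lact] and
    [ract] of the dual algebra, and passing from C_n to C_(n+1) becomes a condition on the elements
    [lact g c] with [g] zero on the coradical ([coradical_filtrationS]).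

    On A, coordinates [pi m n] along the monomials X+^m X-^n come from an explicit module over A
    ([pbw_coordinates]), and [pbw_span] shows that they determine an element. The key computation is
    [lact_coordinate]: acting by [f \o pi j l] moves the coordinate at (m+j, n+l) to (m, n), up to
    the action of [f], a grouplike factor and the scalar [comul_coef], a product of q-binomials and
    a power of [xi].

    The candidate [pbw_filtration t] asks the coordinate at (m, n) to lie in R_(t - hat m - hat n).
    Its level 0 is the coradical, by [simple_subcoalgebra_range]. The induction in
    [coradical_filtration_ambiskew] rests on two complementary facts. A nonzero q-binomial always
    lowers the hat ([hat_of_sub_lt]), so no term of [lact g x] leaves level t
    ([lact_pbw_filtration]). Some nonzero q-binomial lowers it by exactly one
    ([exists_hat_of_pred]), so a coordinate beyond the allowed level is detected
    ([pbw_filtration_sub]). *)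

(** * Linear subspaces and separation by functionals *)

Section Subspaces.
Variable k : fieldType.
Implicit Types U V W : lmodType k.

Lemma subspaceD V (D : set V) u v : subspace D -> D u -> D v -> D (u + v).
Proof. by case=> _ cD Du Dv; rewrite -[u]scale1r; exact: cD. Qed.

Lemma subspaceZ V (D : set V) a u : subspace D -> D u -> D (a *: u).
Proof. by case=> D0 cD Du; rewrite -[_ *: _]addr0; exact: cD. Qed.

Lemma subspaceB V (D : set V) u v : subspace D -> D u -> D v -> D (u - v).
Proof.
by move=> sD Du Dv; rewrite -scaleN1r; exact: subspaceD sD Du (subspaceZ _ sD Dv).
Qed.

Lemma subspace_sum V (D : set V) (I : Type) (r : seq I) (P : pred I) (F : I -> V) :
  subspace D -> (forall j, P j -> D (F j)) -> D (\sum_(j <- r | P j) F j).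
Proof. by move=> sD DF; apply: big_ind => // [|u v]; [case: sD | exact: subspaceD]. Qed.

Lemma subspace0 V : subspace [set 0 : V].
Proof. by split=> // a u v -> ->; rewrite scaler0 addr0. Qed.

Lemma subspaceI V (D E : set V) : subspace D -> subspace E -> subspace (D `&` E).
Proof.
by move=> [D0 cD] [E0 cE]; split=> // a u v [Du Eu] [Dv Ev]; split; [exact: cD | exact: cE].
Qed.

Lemma subspace_preimage V W (f : {linear V -> W}) (D : set W) :
  subspace D -> subspace (f @^-1` D).
Proof.
by move=> [D0 cD]; split=> [|a u v] /=; rewrite ?linear0 // linearP; exact: cD.
Qed.

Lemma subspace_image V W (f : {linear V -> W}) (D : set V) :
  subspace D -> subspace (f @` D).
Proof.
move=> [D0 cD]; split=> [|a _ _ [u Du <-] [v Dv <-]]; first by exists 0; rewrite ?linear0.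
by exists (a *: u + v); [exact: cD | rewrite linearP].
Qed.

Lemma lspan_subspace V (S : set V) : subspace (lspan S).
Proof.
split=> [B [[B0 _] _] // | a u v Su Sv B BS].
by apply: BS.1.2; [exact: Su | exact: Sv].
Qed.

Lemma sub_lspan V (S : set V) : S `<=` lspan S.
Proof. exact: sub_gen_smallest. Qed.

Lemma lspan_sub V (S D : set V) : subspace D -> S `<=` D -> lspan S `<=` D.
Proof. by move=> sD SD; exact: smallest_sub. Qed.

Lemma add_subspace_subspace V (D E : set V) :
  subspace D -> subspace E -> subspace (add_subspace D E).
Proof.
move=> [D0 cD] [E0 cE]; split=> [|a _ _ [u Du [v Ev <-]] [u' Du' [v' Ev' <-]]].
  by exists 0 => //; exists 0 => //; rewrite addr0.
exists (a *: u + u'); [exact: cD | exists (a *: v + v'); first exact: cE].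
by rewrite scalerDr addrACA.
Qed.

(** A subspace [Y] containing [E] and maximal among those that miss [v] is a hyperplane
    complementing the line of [v]; the functional reads the coefficient of [v] modulo [Y]. *)
Lemma exists_functional V (E : set V) (v : V) :
  subspace E -> ~ E v ->
  exists g : {scalar V}, (forall u, E u -> g u = 0) /\ g v = 1.
Proof.
move=> sE nEv.
(* Zorn's lemma also requires the union of the empty chain; joining [E] to [X] turns it into [E]
   itself. *)
pose P X := subspace (E `|` X) /\ ~ (E `|` X) v.
have [F FP totF|A [[sY nYv] maxA]] := @Zorn_bigcup V P.
  split; last by case=> // -[X /FP[_ nX] Xv]; apply: nX; right.
  split=> [|a u w]; first by left; case: sE.
  have step X : F X -> (E `|` X) u -> (E `|` X) w ->
      (E `|` \bigcup_(X in F) X) (a *: u + w).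
    move=> FX Xu Xw; have [[_ cX] _] := FP X FX.
    by have [?|?] := cX a u w Xu Xw; [left | right; exists X].
  case=> [Eu|[X FX Xu]] [Ew|[X' FX' Xw]].
  - by left; apply: sE.2.
  - by apply: (step X') => //; [left|right].
  - by apply: (step X) => //; [right|left].
  - have [XX'|X'X] := totF _ _ FX FX'.
      by apply: (step X') => //; right => //; exact: XX'.
    by apply: (step X) => //; right => //; exact: X'X.
set Y := E `|` A in sY nYv.
have YE u : E u -> Y u by left.
have coord u : exists a, Y (u - a *: v).
  have [Yu|nYu] := pselect (Y u); first by exists 0; rewrite scale0r subr0.
  pose B := [set y + b *: u | y in Y & b in [set: k]].
  have YB y : Y y -> B y by move=> Yy; exists y => //; exists 0 => //; rewrite scale0r addr0.
  have sB : subspace B.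
    split=> [|a _ _ [y Yy [b _ <-]] [y' Yy' [b' _ <-]]]; first by apply: YB; case: sY.
    exists (a *: y + y'); [exact: sY.2 | exists (a * b + b') => //].
    by rewrite scalerDr scalerDl scalerA addrACA.
  have EB : E `|` B = B by apply/setUidPr => w Ew; apply: YB; exact: YE.
  (* [B] is spanned by [Y] and [u] and strictly exceeds [A], so by maximality it contains [v];
     solving for [u] gives its coefficient. *)
  have : ~ P B.
    apply: maxA; split=> [w Aw|BA]; first by apply: YB; right.
    by apply: nYu; right; apply: BA; exists 0; [case: sY | exists 1; rewrite // scale1r add0r].
  move=> /not_andP; rewrite EB => -[//|/contrapT[y Yy [b _ vE]]].
  have b0 : b != 0.
    by apply: contra_notN nYv => /eqP b0; rewrite -vE b0 scale0r addr0.
  exists b^-1; rewrite -vE scalerDr scalerA mulVf // scale1r opprD addrCA subrr addr0.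
  by rewrite -scaleNr; exact: subspaceZ.
pose f u := projT1 (cid (coord u)).
have fP u : Y (u - f u *: v) := projT2 (cid (coord u)).
have uniq a : Y (a *: v) -> a = 0.
  move=> Yav; apply/eqP; apply: contra_notT nYv => a0.
  by rewrite -[v]scale1r -(mulVf a0) -scalerA; exact: subspaceZ.
have uniq2 u a : Y (u - a *: v) -> f u = a.
  move=> Ya; apply/eqP; rewrite -subr_eq0; apply/eqP/uniq.
  have := subspaceB sY Ya (fP u).
  by rewrite opprB addrC -addrA addKr -scalerBl.
have flin : scalar f.
  move=> a u w; apply: uniq2.
  have := sY.2 a _ _ (fP u) (fP w).
  by rewrite scalerBr scalerA addrACA -opprD -scalerDl.
pose g : {scalar V} := HB.pack f (GRing.isLinear.Build k V k _ f flin).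
exists g; split=> [u Eu|]; apply: uniq2; last by rewrite scale1r subrr; case: sY.
by rewrite scale0r subr0; left.
Qed.

Lemma functional_sepP V (E : set V) v : subspace E ->
  E v <-> forall g : {scalar V}, (forall u, E u -> g u = 0) -> g v = 0.
Proof.
move=> sE; split=> [Ev g /(_ _ Ev)//|gv]; apply: contrapT => nEv.
have [g [gE g1]] := exists_functional sE nEv.
by have /eqP := gv g gE; rewrite g1 oner_eq0.
Qed.

End Subspaces.

(** * Contractions and membership in tensor subspaces *)

Section Contraction.
Variable k : fieldType.
Implicit Types U V W : lmodType k.

Definition contractr V W (g : {scalar W}) (x : tensor V W) : V :=
  tlift (fun v w => g w *: v) x.
Definition contractl V W (g : {scalar V}) (x : tensor V W) : W :=
  tlift (fun v w => g v *: w) x.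

Lemma contractr_bilin V W (g : {scalar W}) :
  bilinear_for *:%R *:%R (fun (v : V) w => g w *: v).
Proof.
split=> [w a v v'|v a w w'] /=; first by rewrite scalerDr !scalerA mulrC.
by rewrite linearP scalerDl scalerA.
Qed.

Lemma contractl_bilin V W (g : {scalar V}) :
  bilinear_for *:%R *:%R (fun v (w : W) => g v *: w).
Proof.
split=> [w a v v'|v a w w'] /=; last by rewrite scalerDr !scalerA mulrC.
by rewrite linearP scalerDl scalerA.
Qed.

HB.instance Definition _ V W (g : {scalar W}) :=
  GRing.isLinear.Build k (tensor V W) V _ (contractr g)
    (tlift_linear (contractr_bilin V g)).
HB.instance Definition _ V W (g : {scalar V}) :=
  GRing.isLinear.Build k (tensor V W) W _ (contractl g)
    (tlift_linear (contractl_bilin W g)).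

Lemma contractrE V W (g : {scalar W}) (v : V) w : contractr g (v \ox w) = g w *: v.
Proof. exact: (tlift_tens (contractr_bilin V g)). Qed.

Lemma contractlE V W (g : {scalar V}) v (w : W) : contractl g (v \ox w) = g v *: w.
Proof. exact: (tlift_tens (contractl_bilin W g)). Qed.

Lemma tens0l V W (w : W) : (0 : V) \ox w = 0.
Proof. by rewrite -(scale0r 0) tensZl scale0r. Qed.

Lemma tens0r V W (v : V) : v \ox (0 : W) = 0.
Proof. by rewrite -(scale0r 0) tensZr scale0r. Qed.

Lemma tens_suml V W I (r : seq I) (P : pred I) (F : I -> V) (w : W) :
  (\sum_(j <- r | P j) F j) \ox w = \sum_(j <- r | P j) F j \ox w.
Proof. by apply: (big_morph (fun v => v \ox w)) => [u v|]; rewrite ?tensDl ?tens0l. Qed.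

Lemma tens_sumr V W I (r : seq I) (P : pred I) (v : V) (F : I -> W) :
  v \ox (\sum_(j <- r | P j) F j) = \sum_(j <- r | P j) v \ox F j.
Proof. by apply: (big_morph (fun w => v \ox w)) => [u w|]; rewrite ?tensDr ?tens0r. Qed.

(** The dichotomy behind the inductions on the length of a tensor: a factor either can be absorbed
    by the other terms modulo [E], or is isolated by a functional that kills [E] and those terms. *)
Lemma span_or_sep W (E : set W) (s : seq W) w : subspace E ->
  (exists c : nat -> k, E (w - \sum_(j < size s) c j *: s`_j)) \/
  (exists g : {scalar W}, [/\ forall u, E u -> g u = 0,
      forall u, u \in s -> g u = 0 & g w = 1]).
Proof.
move=> sE; pose D := [set u | exists c : nat -> k, E (u - \sum_(j < size s) c j *: s`_j)].
have [|nDw] := pselect (D w); [by left | right].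
have sD : subspace D.
  split=> [|a u v [c Ec] [d Ed]].
    by exists (fun=> 0); rewrite big1 ?subr0 => [|j _]; [case: sE | rewrite scale0r].
  exists (fun j => a * c j + d j).
  have -> : \sum_(j < size s) (a * c j + d j) *: s`_j
      = a *: (\sum_(j < size s) c j *: s`_j) + \sum_(j < size s) d j *: s`_j.
    rewrite scaler_sumr -big_split; apply: eq_bigr => j _.
    by rewrite scalerA scalerDl.
  by rewrite opprD addrACA -scalerBr; exact: sE.2.
have [g [gD g1]] := exists_functional sD nDw.
exists g; split=> // u => [Eu|su].
  by apply: gD; exists (fun=> 0); rewrite big1 ?subr0 // => j _; rewrite scale0r.
apply: gD; exists (fun j => (j == index u s)%:R).
have us : (index u s < size s)%N by rewrite index_mem.
rewrite (bigD1 (Ordinal us)) //= eqxx scale1r nth_index // big1 ?addr0 ?subrr.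
  by case: sE.
by move=> j /negPf; rewrite -val_eqE /= => ->; rewrite scale0r.
Qed.


Lemma contractr_sum V W (g : {scalar W}) (s : seq (V * W)) :
  contractr g (\sum_(p <- s) p.1 \ox p.2) = \sum_(p <- s) g p.2 *: p.1.
Proof. by rewrite linear_sum; apply: eq_bigr => p _ /=; rewrite contractrE. Qed.

Lemma contractl_sum V W (g : {scalar V}) (s : seq (V * W)) :
  contractl g (\sum_(p <- s) p.1 \ox p.2) = \sum_(p <- s) g p.1 *: p.2.
Proof. by rewrite linear_sum; apply: eq_bigr => p _ /=; rewrite contractlE. Qed.

Lemma tens_subspace V W (D : set V) (E : set W) v w :
  D v -> E w -> tensor_subspace D E (v \ox w).
Proof. by move=> Dv Ew; apply: sub_lspan; exists v => //; exists w. Qed.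

Lemma contractr_subspace V W (D : set V) (E : set W) (g : {scalar W}) x :
  subspace D -> tensor_subspace D E x -> D (contractr g x).
Proof.
move=> sD; apply: (lspan_sub (subspace_preimage (contractr g) sD)).
by move=> _ [v Dv [w _ <-]] /=; rewrite contractrE; exact: subspaceZ.
Qed.

Lemma contractl_subspace V W (D : set V) (E : set W) (g : {scalar V}) x :
  subspace E -> tensor_subspace D E x -> E (contractl g x).
Proof.
move=> sE; apply: (lspan_sub (subspace_preimage (contractl g) sE)).
by move=> _ [v Dv [w Ew <-]] /=; rewrite contractlE; exact: subspaceZ.
Qed.

Lemma contractr_eq0 V W (D : set V) (E : set W) (g : {scalar W}) x :
  (forall w, E w -> g w = 0) -> tensor_subspace D E x -> contractr g x = 0.
Proof.
move=> gE; apply: (lspan_sub (subspace_preimage (contractr g) (@subspace0 k V))).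
by move=> _ [v _ [w Ew <-]] /=; rewrite contractrE gE // scale0r.
Qed.

(** The converse goes by induction on the number of pure tensors in [x], with [span_or_sep] applied
    to the second factor of the first one. *)
Lemma contractr_add_subspaceP V W (D : set V) (E : set W) x :
  subspace D -> subspace E ->
  add_subspace (tensor_subspace D setT) (tensor_subspace setT E) x <->
  forall g : {scalar W}, (forall w, E w -> g w = 0) -> D (contractr g x).
Proof.
move=> sD sE; split=> [[y Dy [z Ez <-]] g gE|].
  rewrite linearD /=; apply: (subspaceD sD); first exact: contractr_subspace sD Dy.
  by rewrite (contractr_eq0 gE Ez); case: sD.
set T := add_subspace _ _.
have sT : subspace T by apply: add_subspace_subspace; exact: lspan_subspace.
have TD v w : D v -> T (v \ox w).
  move=> Dv; exists (v \ox w); first exact: tens_subspace.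
  by exists 0; [exact: (lspan_subspace _).1 | rewrite addr0].
have TE v w : E w -> T (v \ox w).
  move=> Ew; exists 0; first exact: (lspan_subspace _).1.
  by exists (v \ox w); [exact: tens_subspace | rewrite add0r].
rewrite (tensor_sum x).
have [n] := ubnP (size (repr x)); elim: n (repr x) => // n IHn [|[v w] s] /=.
  by move=> _ _; rewrite big_nil; case: sT.
rewrite ltnS => sz Dx.
have [[c Ec]|[g [gE gs gw]]] := span_or_sep [seq p.2 | p <- s] w sE; last first.
  (* Contracting with [g] leaves exactly [v], so the first term can be split off. *)
  have Dv : D v.
    have := Dx g gE; rewrite contractr_sum big_cons /= gw scale1r big_seq big1 ?addr0 //.
    by move=> p ps; rewrite gs ?scale0r //; exact: map_f.
  rewrite big_cons; apply: (subspaceD sT); first exact: TD.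
  apply: IHn => // g' g'E.
  have := Dx g' g'E; rewrite !contractr_sum big_cons => Dx'.
  rewrite -[X in D X](addKr (g' w *: v)) addrC; apply: (subspaceB sD) => //.
  exact: subspaceZ.
(* Here [w] is, modulo [E], a combination of the other second factors; distributing [v] over them
   shortens the sum by one term. *)
pose F j := ((nth (v, w) s j).1 + c j *: v, (nth (v, w) s j).2).
have xE : \sum_(p <- (v, w) :: s) p.1 \ox p.2 =
    v \ox (w - \sum_(j < size s) c j *: (nth (v, w) s j).2)
    + \sum_(p <- [seq F j | j <- iota 0 (size s)]) p.1 \ox p.2.
  rewrite big_cons big_map tensDr -addrA; congr (_ + _).
  have -> : iota 0 (size s) = index_iota 0 (size s) by rewrite /index_iota subn0.
  rewrite big_mkord -scaleN1r tensZr tens_sumr scaler_sumr -big_split /=.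
  rewrite (big_nth (v, w)) big_mkord.
  apply: eq_bigr => j _; rewrite tensDl tensZl tensZr addrCA scaleN1r.
  by rewrite addNr addr0.
have {}Ec : E (w - \sum_(j < size s) c j *: (nth (v, w) s j).2).
  congr (E (_ - _)) : Ec; rewrite size_map; apply: eq_bigr => j _.
  by rewrite (nth_map (v, w)).
rewrite xE in Dx *; apply: (subspaceD sT); first exact: TE.
apply: IHn => [|g gE]; first by rewrite size_map size_iota.
by have := Dx g gE; rewrite linearD /= contractrE gE // scale0r add0r.
Qed.

Lemma contractr_subspaceP V W (D : set V) x : subspace D ->
  (forall g : {scalar W}, D (contractr g x)) -> tensor_subspace D setT x.
Proof.
move=> sD Dx.
have [|y Dy [z z0 <-]] := (contractr_add_subspaceP x sD (@subspace0 k W)).2.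
  by move=> g _; exact: Dx.
suff -> : z = 0 by rewrite addr0.
apply: (lspan_sub (@subspace0 k (tensor V W))) z0.
by move=> _ [v _ [w /= -> <-]]; rewrite tens0r.
Qed.

Lemma tensor_subspaceP V W (D : set V) (E : set W) x :
  subspace D -> subspace E ->
  tensor_subspace D E x <->
  (forall g : {scalar W}, D (contractr g x)) /\
  (forall f : {scalar V}, E (contractl f x)).
Proof.
move=> sD sE; split=> [DEx|[Dx Ex]].
  by split=> g; [exact: contractr_subspace DEx | exact: contractl_subspace DEx].
have [s xE sDs] : exists2 s : seq (V * W),
    x = \sum_(p <- s) p.1 \ox p.2 & forall p, p \in s -> D p.1.
  have := contractr_subspaceP sD Dx.
  pose Q y := exists2 s : seq (V * W),
    y = \sum_(p <- s) p.1 \ox p.2 & forall p, p \in s -> D p.1.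
  have sQ : subspace Q.
    split=> [|a _ _ [s -> Ds] [s' -> Ds']]; first by exists [::]; rewrite ?big_nil.
    exists ([seq (a *: p.1, p.2) | p <- s] ++ s') => [|p].
      rewrite big_cat big_map scaler_sumr; congr (_ + _).
      by apply: eq_bigr => p _; rewrite tensZl.
    rewrite mem_cat => /orP[/mapP[q /Ds Dq ->]|/Ds'//] /=.
    exact: subspaceZ.
  apply: (lspan_sub sQ) => _ [v Dv [w _ <-]].
  by exists [:: (v, w)]; rewrite ?big_seq1 // => p; rewrite inE => /eqP ->.
rewrite {x Dx}xE in Ex *; have sT := lspan_subspace [set v \ox w | v in D & w in E].
have [n] := ubnP (size s); elim: n s sDs Ex => // n IHn [|[v w] s] /= sDs Ex.
  by move=> _; rewrite big_nil; case: sT.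
have Dv : D v by apply: (sDs (v, w)); rewrite mem_head.
have Ds p : p \in s -> D p.1 by move=> ps; apply: sDs; rewrite in_cons ps orbT.
rewrite ltnS => sz.
have [[c Ec]|[g [_ gs gv]]] := span_or_sep [seq p.1 | p <- s] v (@subspace0 k V); last first.
  have Ew : E w.
    have := Ex g; rewrite contractl_sum big_cons /= gv scale1r big_seq big1 ?addr0 //.
    by move=> p ps; rewrite gs ?scale0r //; exact: map_f.
  rewrite big_cons; apply: (subspaceD sT); first exact: tens_subspace.
  apply: IHn => // f; have := Ex f; rewrite !contractl_sum big_cons => Ex'.
  rewrite -[X in E X](addKr (f v *: w)) addrC; apply: (subspaceB sE) => //.
  exact: subspaceZ.
pose F j := ((nth (v, w) s j).1, (nth (v, w) s j).2 + c j *: w).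
have xE : \sum_(p <- (v, w) :: s) p.1 \ox p.2 =
    \sum_(p <- [seq F j | j <- iota 0 (size s)]) p.1 \ox p.2.
  have vE : v = \sum_(j < size s) c j *: (nth (v, w) s j).1.
    move/eqP: Ec; rewrite subr_eq0 size_map => /eqP {1}->.
    by apply: eq_bigr => j _; rewrite (nth_map (v, w)).
  rewrite {1}vE.
  rewrite big_cons big_map.
  have -> : iota 0 (size s) = index_iota 0 (size s) by rewrite /index_iota subn0.
  rewrite big_mkord tens_suml (big_nth (v, w)) big_mkord -big_split /=.
  by apply: eq_bigr => j _; rewrite tensDr tensZl tensZr addrC.
rewrite xE in Ex *; apply: IHn => //; last by rewrite size_map size_iota.
move=> _ /mapP[j + ->] /=; rewrite mem_iota => js; apply: Ds; exact: mem_nth.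
Qed.

End Contraction.

(** * Linearity of tensor maps and of the associator *)

Section TensorMaps.
Variable k : fieldType.

Lemma tmap_bilin (V V' W W' : lmodType k) (f : {linear V -> V'}) (g : {linear W -> W'}) :
  bilinear_for *:%R *:%R (fun v w => f v \ox g w).
Proof.
split=> [w a u v|v a u w] /=.
  by rewrite linearP tensDl tensZl.
by rewrite linearP tensDr tensZr.
Qed.

HB.instance Definition _ (V V' W W' : lmodType k) (f : {linear V -> V'})
    (g : {linear W -> W'}) :=
  GRing.isLinear.Build k (tensor V W) (tensor V' W') _ (tmap f g)
    (tlift_linear (tmap_bilin f g)).

Lemma tmapE (V V' W W' : lmodType k) (f : {linear V -> V'}) (g : {linear W -> W'}) v w :
  tmap f g (v \ox w) = f v \ox g w.
Proof. exact: (tlift_tens (tmap_bilin f g)). Qed.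

Lemma tassoc_in_bilin (U V W : lmodType k) (w : W) :
  bilinear_for *:%R *:%R (fun (u : U) (v : V) => u \ox (v \ox w)).
Proof.
split=> [v a u u'|u a v v'] /=; first by rewrite tensDl tensZl.
by rewrite tensDl tensZl tensDr tensZr.
Qed.

Lemma tassoc_bilin (U V W : lmodType k) :
  bilinear_for *:%R *:%R
    (fun (x : tensor U V) (w : W) => tlift (fun u v => u \ox (v \ox w)) x).
Proof.
split=> [w a x y|x a w w'] /=; first exact: (tlift_linear (tassoc_in_bilin _ _ w)).
rewrite (tensor_sum x) -tensor_of_sum !(tlift_of (tassoc_in_bilin _ _ _)).
rewrite scaler_sumr -big_split; apply: eq_bigr => p _ /=.
by rewrite !tensDr !tensZr.
Qed.

HB.instance Definition _ (U V W : lmodType k) :=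
  GRing.isLinear.Build k (tensor (tensor U V) W) (tensor U (tensor V W)) _
    (@tassoc k U V W) (tlift_linear (tassoc_bilin U V W)).

Lemma tassocE (U V W : lmodType k) (u : U) (v : V) (w : W) :
  tassoc ((u \ox v) \ox w) = u \ox (v \ox w).
Proof.
by rewrite /tassoc (tlift_tens (tassoc_bilin U V W)) (tlift_tens (tassoc_in_bilin _ _ w)).
Qed.

End TensorMaps.

(** * The dual algebra acting on a coalgebra *)

Section DualAction.
Variables (k : fieldType) (C : coalgType k).
Implicit Types (f g : {scalar C}) (c : C) (D E : set C).

(* The two actions of the dual algebra: lact g c = c_1 g(c_2) and ract g c =  *)
(* g(c_1) c_2 in Sweedler notation.                                           *)
Definition lact g c : C := contractr g (comul c).
Definition ract g c : C := contractl g (comul c).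

HB.instance Definition _ g := GRing.Linear.copy (lact g) (contractr g \o comul).
HB.instance Definition _ g := GRing.Linear.copy (ract g) (contractl g \o comul).

Lemma eq_lact f g c : f =1 g -> lact f c = lact g c.
Proof. by move=> fg; apply: eq_bigr => p _; rewrite fg. Qed.

Lemma eq_ract f g c : f =1 g -> ract f c = ract g c.
Proof. by move=> fg; apply: eq_bigr => p _; rewrite fg. Qed.

Lemma lact_counit c : lact counit c = c.
Proof. exact: counitr. Qed.

Lemma ract_counit c : ract counit c = c.
Proof. exact: counitl. Qed.

(** Both sides are f(c_1) g(c_2). *)
Lemma lact_ract f g c : f (lact g c) = g (ract f c).
Proof.
rewrite /lact /ract.
apply: (tensor_ext (U := k^o) (g := f \o contractr g) (g' := g \o contractl f)) => [||v w].
- exact: linearP.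
- exact: linearP.
- by rewrite /= contractrE contractlE !linearZ /= mulrC.
Qed.

(** Coassociativity: both sides are c_1 f(c_2) g(c_3), and [f \o lact g] is the convolution product
    of [f] and [g]. *)
Lemma lactA f g c : lact f (lact g c) = lact (f \o lact g) c.
Proof.
rewrite {1 2}/lact [in RHS]/lact.
(* [T] contracts the last two of three factors; [comulA] lets it be evaluated on either iterated
   coproduct. *)
pose T : {linear tensor C (tensor C C) -> C} := contractr (f \o contractr g).
transitivity (T (tassoc (tmap comul idfun (comul c)))).
  apply: (tensor_ext (g := contractr f \o comul \o contractr g)
    (g' := T \o @tassoc k C C C \o tmap comul idfun)) => [||v w].
  - exact: linearP.
  - exact: linearP.
  - rewrite /= contractrE tmapE /= linearZ /= linearZ /=.
    move: (comul v); apply: tensor_ext => [a x y|a x y|u z] /=.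
    + by rewrite linearP /= scalerDr !scalerA mulrC.
    + by rewrite tensDl tensZl !linearP.
    + by rewrite tassocE !contractrE /= contractrE [f (_ *: _)]linearZ scalerA.
rewrite comulA; apply: (tensor_ext (g := T \o tmap idfun comul)
  (g' := contractr (f \o lact g))) => [||v w].
- exact: linearP.
- exact: linearP.
- by rewrite /= tmapE /T !contractrE.
Qed.

Lemma subcoalgebraP D :
  subcoalgebra D <->
  subspace D /\ forall c, D c -> forall g, D (lact g c) /\ D (ract g c).
Proof.
split=> -[sD cD]; split=> // c Dc.
  by move=> g; have [/(_ g) + /(_ g)] := (tensor_subspaceP _ sD sD).1 (cD c Dc).
by apply/tensor_subspaceP => //; split=> g; have [] := cD c Dc g.
Qed.

Lemma subcoalgebraI D E : subcoalgebra D -> subcoalgebra E -> subcoalgebra (D `&` E).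
Proof.
move=> /subcoalgebraP[sD cD] /subcoalgebraP[sE cE].
apply/subcoalgebraP; split=> [|c [Dc Ec] g]; first exact: subspaceI.
by have [] := cD c Dc g; have [] := cE c Ec g.
Qed.

Lemma coradical_subcoalgebra : subcoalgebra (coradical C).
Proof.
apply/subcoalgebraP; have sC := lspan_subspace (\bigcup_(D in simple_subcoalgebra (C:=C)) D).
split=> // c Cc g; split; move: c Cc.
  apply: (lspan_sub (subspace_preimage (lact g) sC)) => c [D simD Dc].
  apply: sub_lspan; exists D => //.
  by have [/subcoalgebraP[_ /(_ c Dc g)[]]] := simD.
apply: (lspan_sub (subspace_preimage (ract g) sC)) => c [D simD Dc].
apply: sub_lspan; exists D => //.
by have [/subcoalgebraP[_ /(_ c Dc g)[]]] := simD.
Qed.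

Lemma coradical_filtration_subspace n : subspace (coradical_filtration C n).
Proof.
case: n => [|n] /=; first exact: lspan_subspace.
apply: (subspace_preimage comul).
by apply: add_subspace_subspace; exact: lspan_subspace.
Qed.

Lemma coradical_filtrationS n c :
  coradical_filtration C n.+1 c <->
  forall g, (forall x, coradical C x -> g x = 0) -> coradical_filtration C n (lact g c).
Proof.
apply: contractr_add_subspaceP; first exact: coradical_filtration_subspace.
exact: lspan_subspace.
Qed.

Lemma lact_coradical_eq0 g c :
  (forall x, coradical C x -> g x = 0) -> coradical C c -> lact g c = 0.
Proof. by move=> g0 /coradical_subcoalgebra.2; exact: contractr_eq0. Qed.

(** The bottom case of [coradical_filtrationS], with 0 in place of C_(-1): since g(c) = counit (lact
    g c), every functional that kills the coradical kills [c]. *)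
Lemma coradicalP c :
  (forall g, (forall x, coradical C x -> g x = 0) -> lact g c = 0) -> coradical C c.
Proof.
move=> c0; apply/functional_sepP => [|g g0]; first exact: lspan_subspace.
by rewrite -[c]ract_counit -lact_ract c0 // linear0.
Qed.

Lemma coradical_filtration_leq m n c : (m <= n)%N ->
  coradical_filtration C m c -> coradical_filtration C n c.
Proof.
have incS p : coradical_filtration C p `<=` coradical_filtration C p.+1.
  elim: p => [|p IHp] x Cx; apply/coradical_filtrationS => g g0.
    rewrite lact_coradical_eq0 //; exact: (coradical_filtration_subspace 0).1.
  by apply: IHp; exact: (coradical_filtrationS p x).1.
by elim: n => [|n IHn]; rewrite leq_eqVlt => /orP[/eqP->//|//] /IHn H /H /incS.
Qed.

(** The coradical is a subcoalgebra, so [f \o lact g] kills it whenever [f] does; [lactA] then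
    reduces the claim to membership of [c] itself. *)
Lemma lact_coradical_filtration n g c :
  coradical_filtration C n c -> coradical_filtration C n (lact g c).
Proof.
case: n => [/=|n]; first by have /subcoalgebraP[_ cC] := coradical_subcoalgebra;
  move=> /cC/(_ g)[].
move=> /coradical_filtrationS Cc; apply/coradical_filtrationS => f f0.
rewrite lactA; apply: Cc => x /=.
by have /subcoalgebraP[_ cC] := coradical_subcoalgebra; move=> /cC/(_ g)[/f0].
Qed.

End DualAction.

(** * Embeddings of coalgebras with a linear retraction *)

Section CoalgebraEmbedding.
Variables (k : fieldType) (C C' : coalgType k).
Variables (phi : {linear C -> C'}) (rho : {linear C' -> C}).
Hypothesis comul_phi : forall c, comul (phi c) = tmap phi phi (comul c).
Hypothesis phiK : cancel phi rho.

Lemma lact_comorphism (g : {scalar C'}) c :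
  lact g (phi c) = phi (lact (g \o phi) c).
Proof.
rewrite /lact comul_phi.
apply: (tensor_ext (g := contractr g \o tmap phi phi)
  (g' := phi \o contractr (g \o phi))) => [||v w]; try exact: linearP.
by rewrite /= tmapE !contractrE linearZ.
Qed.

Lemma ract_comorphism (g : {scalar C'}) c :
  ract g (phi c) = phi (ract (g \o phi) c).
Proof.
rewrite /ract comul_phi.
apply: (tensor_ext (g := contractl g \o tmap phi phi)
  (g' := phi \o contractl (g \o phi))) => [||v w]; try exact: linearP.
by rewrite /= tmapE !contractlE linearZ.
Qed.

Lemma subcoalgebra_image D : subcoalgebra D -> subcoalgebra (phi @` D).
Proof.
move=> /subcoalgebraP[sD cD]; apply/subcoalgebraP; split=> [|_ [c Dc <-] g].
  exact: subspace_image.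
have [Dl Dr] := cD c Dc (g \o phi).
by rewrite lact_comorphism ract_comorphism; split; [exists (lact (g \o phi) c) | exists (ract (g \o phi) c)].
Qed.

(** The retraction extends each functional [g] on C to [g \o rho] on C', so the actions on C are
    restrictions of actions on C'. *)
Lemma subcoalgebra_preimage E : subcoalgebra E -> subcoalgebra (phi @^-1` E).
Proof.
move=> /subcoalgebraP[sE cE]; apply/subcoalgebraP; split=> [|c Ec g].
  exact: subspace_preimage.
have gE : g =1 g \o rho \o phi by move=> x; rewrite /= phiK.
rewrite (eq_lact c gE) (eq_ract c gE).
have [] := cE (phi c) Ec (g \o rho).
by rewrite lact_comorphism ract_comorphism.
Qed.

Lemma image_preimage_sub (E : set C') : E `<=` range phi -> phi @` (phi @^-1` E) = E.
Proof.
move=> Er; apply/seteqP; split=> [_ [c Ec <-]//|x Ex].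
by have [c _ cx] := Er x Ex; exists c; rewrite /preimage /= cx.
Qed.

Lemma preimage_image_can (D : set C) : phi @^-1` (phi @` D) = D.
Proof.
apply/seteqP; split=> [c [d Dd /(can_inj phiK) <-]//|c Dc].
by exists c.
Qed.

Lemma image_set0v : phi @` [set 0] = [set 0].
Proof. by rewrite image_set1 linear0. Qed.

Lemma simple_subcoalgebra_image D :
  simple_subcoalgebra D -> simple_subcoalgebra (phi @` D).
Proof.
move=> [sD D0 minD]; split; first exact: subcoalgebra_image.
  move=> /(congr1 (preimage phi)); rewrite preimage_image_can -image_set0v.
  by rewrite preimage_image_can.
move=> E sE ED.
have Er : E `<=` range phi by move=> x /ED[c _ <-]; exists c.
have [||E0|ED'] := minD (phi @^-1` E).
- exact: subcoalgebra_preimage.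
- by rewrite -[X in _ `<=` X]preimage_image_can; exact: preimage_subset.
- by left; rewrite -(image_preimage_sub Er) E0 image_set0v.
- by right; rewrite -(image_preimage_sub Er) ED'.
Qed.

Lemma simple_subcoalgebra_preimage E : E `<=` range phi ->
  simple_subcoalgebra E -> simple_subcoalgebra (phi @^-1` E).
Proof.
move=> Er [sE E0 minE]; split; first exact: subcoalgebra_preimage.
  move=> E0'; apply: E0.
  by rewrite -(image_preimage_sub Er) E0' image_set0v.
move=> D sD DE.
have [||D0|DE'] := minE (phi @` D).
- exact: subcoalgebra_image.
- by move=> _ [c /DE Dc <-].
- by left; rewrite -[D]preimage_image_can D0 -image_set0v preimage_image_can.
- by right; rewrite -[D]preimage_image_can DE'.
Qed.

Lemma coradical_image c : coradical C c -> coradical C' (phi c).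
Proof.
apply: (lspan_sub (subspace_preimage phi (@lspan_subspace k C' _))) => x [D simD Dx].
apply: sub_lspan; exists (phi @` D); last by exists x.
exact: simple_subcoalgebra_image.
Qed.

Lemma coradical_filtration_image n c :
  coradical_filtration C n c -> coradical_filtration C' n (phi c).
Proof.
elim: n c => [|n IHn] c; first exact: coradical_image.
move=> /coradical_filtrationS Cc; apply/coradical_filtrationS => g g0.
rewrite lact_comorphism; apply/IHn/Cc => x /coradical_image Cx /=; exact: g0.
Qed.

(** Image and preimage under [phi] exchange the simple subcoalgebras of C with those of C' that lie
    in the range. *)
Lemma coradical_embedding :
  (forall E, simple_subcoalgebra E -> E `<=` range phi) ->
  coradical C' = phi @` coradical C.
Proof.
move=> simr; apply/seteqP; split; last by move=> _ [c Cc <-]; exact: coradical_image.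
apply: lspan_sub; first by apply: subspace_image; exact: lspan_subspace.
move=> x [E simE Ex]; have [c _ cx] := simr E simE x Ex.
exists c => //; apply: sub_lspan; exists (phi @^-1` E); last by rewrite /preimage /= cx.
exact: simple_subcoalgebra_preimage (simr E simE) simE.
Qed.

End CoalgebraEmbedding.

(** * Gaussian binomial coefficients and the q-Lucas theorem *)

Section QBinomial.
Variable k : fieldType.
Implicit Types z : k.

(** Given by Pascal's rule, because the quotient of q-factorials breaks down when [z] is a root of
    unity. *)
Fixpoint qbinomial z m j : k :=
  match m, j with
  | _, 0%N => 1
  | 0%N, _.+1 => 0
  | m'.+1, j'.+1 => z ^+ j'.+1 * qbinomial z m' j'.+1 + qbinomial z m' j'
  end.

Lemma qbinomial0 z m : qbinomial z m 0 = 1.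
Proof. by case: m. Qed.

Lemma qbinomial_small z m j : (m < j)%N -> qbinomial z m j = 0.
Proof.
elim: m j => [|m IHm] [|j] //=; rewrite ltnS => mj.
by rewrite !IHm ?mulr0 ?addr0 // ltnW.
Qed.

Lemma qbinomialnn z m : qbinomial z m m = 1.
Proof. by elim: m => //= m ->; rewrite qbinomial_small ?mulr0 ?add0r. Qed.

(* The case j <= m is [j+1] C(m, j+1) = [m-j] C(m, j) for q-integers, with    *)
(* denominators and truncated subtractions cleared.                           *)
Lemma qbinomial_step z m j :
  z ^+ j * (z ^+ j.+1 - 1) * qbinomial z m j.+1 = (z ^+ m - z ^+ j) * qbinomial z m j.
Proof.
elim: m j => [|m IHm] j; first by case: j => [|j]; rewrite /= ?subrr ?mul0r !mulr0.
case: j => [|j] /=.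
  have := IHm 0%N; rewrite !qbinomial0 /= expr0 !mul1r expr1 exprS mulr1 => IH0.
  by transitivity (z * ((z - 1) * qbinomial z m 1) + (z - 1)); [ring | rewrite IH0; ring].
have := IHm j.+1; have := IHm j; rewrite !exprS.
move: (qbinomial z m j.+2) (qbinomial z m j.+1) (qbinomial z m j) => b2 b1 b0.
move: (z ^+ m) (z ^+ j) => zm zj IH0 IH1.
transitivity (z * (z * zj) * (z * zj * (z * (z * zj) - 1) * b2)
    + z * zj * (z * (z * zj) - 1) * b1); first by ring.
by rewrite IH1; transitivity ((z * zm - z * zj) * (z * zj) * b1 + z * ((zm - zj) * b0));
  [rewrite -IH0; ring | ring].
Qed.

(** In [qbinomial_step] with m = d, the right side vanishes at j = 0 because z^d = 1, and later by
    induction, while z^(j+1) - 1 is nonzero below the order. *)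
Lemma qbinomial_prim_eq0 z d j : d.-primitive_root z -> (0 < j < d)%N -> qbinomial z d j = 0.
Proof.
move=> zd; have z0 : z != 0.
  apply/eqP => z0; have /eqP := prim_expr_order zd.
  by rewrite z0 expr0n gtn_eqF ?(prim_order_gt0 zd) // eq_sym oner_eq0.
elim: j => // j IHj /andP[_ jd]; apply/eqP.
have := qbinomial_step z d j; rewrite (prim_expr_order zd) -mulrA => e.
have : z ^+ j * ((z ^+ j.+1 - 1) * qbinomial z d j.+1) == 0.
  rewrite e; case: j jd IHj {e} => [|j] jd IHj; first by rewrite subrr mul0r.
  by rewrite IHj ?mulr0 //= ltnW.
rewrite !mulf_eq0 expf_eq0 (negPf z0) andbF /= subr_eq0 => /orP[|//].
by rewrite -(prim_order_dvd zd) gtnNdvd.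
Qed.

(** Pascal's rule, one row at a time, followed through the digits (q, r) and (s, u) of row and
    column. *)
Lemma qbinomial_lucas z d q r s u : d.-primitive_root z -> (r < d)%N -> (u < d)%N ->
  qbinomial z (q * d + r) (s * d + u) = 'C(q, s)%:R * qbinomial z r u.
Proof.
move=> zd; have d0 := prim_order_gt0 zd.
have zS i v : z ^+ (i * d + v) = z ^+ v.
  by rewrite exprD mulnC exprM (prim_expr_order zd) expr1n mul1r.
move mE : (q * d + r)%N => m; elim: m q r mE s u => [|m IHm] q r mE s u rd ud.
  move/eqP: mE; rewrite addn_eq0 muln_eq0 (gtn_eqF d0) orbF => /andP[/eqP-> /eqP->].
  case: s => [|s]; first by rewrite bin0 mul1r.
  by rewrite bin_small // mul0r qbinomial_small // addn_gt0 muln_gt0 d0.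
move jE : (s * d + u)%N => j; case: j jE => [|j] jE.
  move/eqP: jE; rewrite addn_eq0 muln_eq0 (gtn_eqF d0) orbF => /andP[/eqP-> /eqP->].
  by rewrite bin0 mul1r !qbinomial0.
(* If r > 0, the preceding row has digits (q, r - 1); if r = 0, it borrows and has digits (q - 1, d
   - 1). The column behaves likewise with s and u. *)
case: r mE rd => [|r] mE rd; last first.
- move: mE; rewrite addnS => -[mE].
  have r'd : (r < d)%N := ltnW rd.
  rewrite /= -jE zS.
  case: u ud jE => [|u] ud jE.
    case: s jE => // s; rewrite addn0 mulSn addnC => jE.
    have {}jE : j = (s * d + d.-1)%N.
      by apply: succn_inj; rewrite -jE -addnS prednK.
    rewrite jE -[(s * d + d)%N]addn0 -{1}mulSnr.
    rewrite (IHm q r) // ?(IHm q r) ?prednK //.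
    rewrite !qbinomial0 expr0 !mul1r (@qbinomial_small _ r) ?mulr0 ?addr0 //.
    by rewrite -ltnS prednK.
  move: jE; rewrite addnS => -[jE]; rewrite -addnS -jE.
  rewrite !(IHm q r) // /=; last exact: ltnW.
  by rewrite mulrDr mulrCA.
- move: mE; rewrite addn0 => mE.
  case: q mE => // q; rewrite mulSn addnC => mE.
  have {}mE : (q * d + d.-1)%N = m by apply: succn_inj; rewrite -mE -addnS prednK.
  have dd : (d.-1 < d)%N by rewrite prednK.
  rewrite /= -jE zS.
  case: u ud jE => [|u] ud jE.
    case: s jE => // s; rewrite addn0 mulSn addnC => jE.
    have {}jE : j = (s * d + d.-1)%N.
      by apply: succn_inj; rewrite -jE -addnS prednK.
    rewrite jE -[(s * d + d)%N]addn0 -{1}mulSnr.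
    rewrite !(IHm q d.-1) // qbinomialnn !qbinomial0 expr0 !mul1r !mulr1.
    by rewrite binS natrD.
  move: jE; rewrite addnS => -[jE]; rewrite -addnS -jE.
  rewrite !(IHm q d.-1) //; last exact: ltnW.
  rewrite mulrCA -mulrDr.
  (* The low digits reassemble to row d at an inner column, which vanishes, as does the right side,
     whose low row is 0. *)
  have -> : z ^+ u.+1 * qbinomial z d.-1 u.+1 + qbinomial z d.-1 u = qbinomial z d u.+1.
    by rewrite -{3}(prednK d0).
  by rewrite (qbinomial_prim_eq0 zd) ?ud // !mulr0.
Qed.

End QBinomial.

(** * How q-binomials change the hat *)

Section HatQBinomial.
Variable k : fieldType.
Hypothesis chark0 : [pchar k] =i pred0.
Implicit Types z : k.

Lemma qbinomial1 z m : (z - 1) * qbinomial z m 1 = z ^+ m - 1.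
Proof. by have := qbinomial_step z m 0; rewrite expr0 expr1 mul1r qbinomial0 mulr1. Qed.

Lemma qbinomial_1_m_1 m : qbinomial (1 : k) m 1 = m%:R.
Proof.
elim: m => //= m ->.
by rewrite qbinomial0 expr1 mul1r [in RHS]mulrS addrC.
Qed.

(** Isolates what is used of a scalar and its modulus, so that it can be applied to [xi] and [xi^-1]
    with the same [d]: powers of X+ expand with q-binomials at [xi], powers of X- with those at
    [xi^-1]. *)
Definition hat_compatible z d :=
  (d = 1%N /\ forall m, (0 < m)%N -> qbinomial z m 1 != 0) \/
  ((1 < d)%N /\ d.-primitive_root z).

Lemma primitive_rootV z d : d.-primitive_root z^-1 = d.-primitive_root z.
Proof.
congr (_ && _); apply: eq_forallb => j.
by rewrite !unity_rootE exprVn invr_eq1.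
Qed.

(** A vanishing q-integer [m] forces z^m = 1. If no order d > 1 occurs, then z = 1 and [m] = m,
    which is nonzero in characteristic 0. *)
Lemma hat_compatible_order xi :
  hat_compatible xi (hat_order xi) /\ hat_compatible xi^-1 (hat_order xi).
Proof.
rewrite /hat_order; case: xgetP => [d _ /andP[d1 xid]|no].
  by split; right; rewrite ?primitive_rootV.
have {}no z : z = xi \/ z = xi^-1 -> forall m, (0 < m)%N -> qbinomial z m 1 != 0.
  move=> zE m m0; apply/eqP => b0.
  have /eqP zm : z ^+ m == 1 by rewrite -subr_eq0 -qbinomial1 b0 mulr0.
  have [d zd _] := prim_order_exists m0 zm.
  have [d1|d1] := ltnP 1 d.
    apply: (no d); apply/andP; split=> //.
    by case: zE zd => ->; rewrite ?primitive_rootV.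
  have {}d1 : d = 1%N by apply/eqP; rewrite eqn_leq d1 (prim_order_gt0 zd).
  have z1 : z = 1 by rewrite -(prim_expr_order zd) d1.
  move/eqP: b0; rewrite z1 qbinomial_1_m_1.
  by rewrite ((pcharf0P k).1 chark0) (gtn_eqF m0).
by split; left; split=> //; apply: no; [left|right].
Qed.

Definition hat_of d m := (m %/ d + m %% d)%N.

Lemma hat_of1 m : hat_of 1 m = m.
Proof. by rewrite /hat_of divn1 modn1 addn0. Qed.

Lemma hat_ofE d q r : (r < d)%N -> hat_of d (q * d + r) = (q + r)%N.
Proof.
move=> rd; have d0 : (0 < d)%N by apply: leq_ltn_trans rd.
by rewrite /hat_of divnMDl // divn_small // addn0 modnMDl modn_small.
Qed.

Lemma hat_of_eq0 d m : (0 < d)%N -> (hat_of d m == 0%N) = (m == 0%N).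
Proof.
move=> d0; rewrite {2}(divn_eq m d) !addn_eq0 muln_eq0 (gtn_eqF d0) orbF.
by [].
Qed.

Lemma hat_compatible_gt0 z d : hat_compatible z d -> (0 < d)%N.
Proof. by case=> [[->]|[/ltnW]]. Qed.

(** By q-Lucas, a nonzero coefficient means that the digits of j are at most those of m, so m - j
    needs no borrow and the hat drops by the digit sum of j. For d = 1 the hat is the identity. *)
Lemma hat_of_sub_lt z d m j : hat_compatible z d -> (0 < j <= m)%N ->
  qbinomial z m j != 0 -> (hat_of d (m - j) < hat_of d m)%N.
Proof.
move=> zd /andP[j0 jm]; have d0 := hat_compatible_gt0 zd.
case: zd => [[-> _ _]|[d1 zd]].
  by rewrite !hat_of1 ltn_subrL j0 (leq_trans j0).
move: j0; rewrite (divn_eq m d) (divn_eq j d).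
have := ltn_pmod m d0; have := ltn_pmod j d0.
move: (m %/ d)%N (m %% d)%N (j %/ d)%N (j %% d)%N => q r s u ud rd su0.
rewrite (qbinomial_lucas _ _ zd) // => nz.
have sq : (s <= q)%N.
  by rewrite leqNgt; apply: contraNN nz => /bin_small ->; rewrite mul0r.
have ur : (u <= r)%N.
  by rewrite leqNgt; apply: contraNN nz => /qbinomial_small ->; rewrite mulr0.
have -> : (q * d + r - (s * d + u) = (q - s) * d + (r - u))%N by rewrite mulnBl; have := leq_mul sq (leqnn d); lia.
rewrite !hat_ofE //; last exact: leq_ltn_trans (leq_subr _ _) rd.
have : (0 < s + u)%N.
  by case: s su0 {nz sq} => // ; rewrite mul0n.
nia.
Qed.

Lemma exists_hat_of_pred z d m : hat_compatible z d -> (0 < m)%N ->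
  exists j, [/\ (0 < j <= m)%N, qbinomial z m j != 0 & (hat_of d (m - j)).+1 = hat_of d m].
Proof.
move=> zd m0; have d0 := hat_compatible_gt0 zd.
case: zd => [[-> nz]|[d1 zd]].
  by exists 1%N; rewrite nz // !hat_of1 subn1 prednK.
have [r0|r0] := posnP (m %% d).
  have mE : m = (m %/ d * d + 0)%N by rewrite {1}(divn_eq m d) r0.
  have q0 : (0 < m %/ d)%N by move: m0; rewrite {1}mE addn0 muln_gt0 => /andP[].
  (* Here m = q d. Removing a full block lowers q, and the coefficient is q, nonzero in
     characteristic 0. *)
  exists d; split.
  - by rewrite d0 {1}mE addn0 leq_pmull.
  - have := qbinomial_lucas (m %/ d) 1 zd d0 d0.
    by rewrite -mE mul1n addn0 qbinomial0 mulr1 bin1 => ->; rewrite ((pcharf0P k).1 chark0) -lt0n.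
  - have := hat_ofE (m %/ d) d0; rewrite -mE addn0 => ->.
    have := hat_ofE (m %/ d).-1 d0; rewrite !addn0 => hE.
    by rewrite {1}mE addn0 -[X in (_ - X)%N]mul1n -mulnBl subn1 hE prednK.
(* The low digit is positive, so removing 1 lowers it, and [m] is nonzero as d does not divide m. *)
exists 1%N; split; first by [].
  apply/eqP => b0; have /eqP := qbinomial1 z m; rewrite b0 mulr0 eq_sym subr_eq0.
  by rewrite -(prim_order_dvd zd) /dvdn (gtn_eqF r0).
rewrite (divn_eq m d) -addnBA // !hat_ofE ?ltn_pmod //; last first.
  by apply: leq_ltn_trans (leq_subr _ _) (ltn_pmod _ d0).
by rewrite -addnS subn1 prednK.
Qed.

End HatQBinomial.

(** * The q-binomial theorem for coproducts *)

Section QBinomialTensor.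
Variables (k : fieldType) (A : algType k).

Lemma tensor_scaleAr (B : algType k) a (x y : tensor A B) : x * (a *: y) = a *: (x * y).
Proof.
have : x * (a *: y + 0) = a *: (x * y) + x * 0 := tensor_mul_linr x a y 0.
by rewrite mulr0 !addr0. Qed.

Lemma tensor_scaleAl (B : algType k) a (x y : tensor A B) : (a *: x) * y = a *: (x * y).
Proof.
have : (a *: x + 0) * y = a *: (x * y) + 0 * y := tensor_mul_linl y a x 0.
by rewrite mul0r !addr0. Qed.

Lemma qcomm_exp (X Y : A) z j : X * Y = z *: (Y * X) -> X * Y ^+ j = z ^+ j *: (Y ^+ j * X).
Proof.
move=> XY; elim: j => [|j IHj]; first by rewrite !expr0 scale1r mulr1 mul1r.
by rewrite [Y ^+ _]exprSr mulrA IHj -scalerAl -(mulrA _ X) XY -scalerAr scalerA -exprSr mulrA.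
Qed.

(** The summands q-commute: (X (x) 1)(Y (x) X) = z (Y (x) X)(X (x) 1). *)
Lemma qbinomial_expr (X Y : A) z m : X * Y = z *: (Y * X) ->
  (X \ox 1 + Y \ox X) ^+ m =
  \sum_(j < m.+1) qbinomial z m j *: ((Y ^+ j * X ^+ (m - j)) \ox X ^+ j).
Proof.
move=> XY; elim: m => [|m IHm].
  by rewrite big_ord1 expr0 scale1r mul1r.
pose T j := (Y ^+ j * X ^+ (m.+1 - j)) \ox X ^+ j.
rewrite exprS IHm mulr_sumr.
transitivity (\sum_(j < m.+1) ((qbinomial z m j * z ^+ j) *: T j + qbinomial z m j *: T j.+1)).
  apply: eq_bigr => j _; rewrite tensor_scaleAr mulrDl !tensM mul1r scalerDr mulrA.
  rewrite (qcomm_exp j XY) -scalerAl tensZl scalerA -mulrA [Y * (_ * _)]mulrA.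
  by rewrite -!exprS /T subSS -subSn // -ltnS.
rewrite big_split [in RHS]big_ord_recl /= -/(T 0%N) big_ord_recl /= -/(T 0%N).
rewrite qbinomial0 mulr1 -!addrA; congr (_ + _).
transitivity (\sum_(j < m.+1) (qbinomial z m j.+1 * z ^+ j.+1) *: T j.+1
    + \sum_(j < m.+1) qbinomial z m j *: T j.+1).
  congr (_ + _); rewrite [RHS]big_ord_recr /= qbinomial_small // mul0r scale0r addr0.
  by [].
rewrite -big_split; apply: eq_bigr => j _ /=.
by rewrite -scalerDl [_ * z ^+ _]mulrC.
Qed.

End QBinomialTensor.

(** * Generation by R, X+ and X- *)

Section Generation.
Variables (k : fieldType) (R A : algType k) (sigma sigmaV : R -> R) (h : R) (xi : k).
Variables (i : {lrmorphism R -> A}) (Xp Xm : A).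
Hypothesis A_ambiskew : is_ambiskew sigma sigmaV h xi i Xp Xm.
Variable P : set A.
Hypothesis P_linear : forall a x y, P x -> P y -> P (a *: x + y).
Hypothesis P_mul : forall x y, P x -> P y -> P (x * y).
Hypotheses (P_R : forall r, P (i r)) (P_Xp : P Xp) (P_Xm : P Xm).

Let S : {pred A} := fun x => `[<P x>].

Let S_closed : GRing.subsemialg_closed S.
Proof.
have P1 : P 1 by rewrite -(rmorph1 i); exact: P_R.
have P0 : P 0 by rewrite -(rmorph0 i); exact: P_R.
split; first exact/asboolP.
- split; first exact/asboolP.
  move=> x y /asboolP Px /asboolP Py; apply/asboolP.
  by rewrite -[x]scale1r; exact: P_linear.
- by move=> a x /asboolP Px; apply/asboolP; rewrite -[_ *: _]addr0; exact: P_linear.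
- by move=> x y /asboolP Px /asboolP Py; apply/asboolP; exact: P_mul.
Qed.

Let B := {x : A | x \in S}.
HB.instance Definition _ := SubType.on B.
HB.instance Definition _ := Choice.on B.
HB.instance Definition _ := GRing.SubChoice_isSubAlgebra.Build k A S B S_closed.

Let f (r : R) : B := exist _ (i r) (asboolT (P_R r)).

Let f_linear : linear f.
Proof. by move=> a r s; apply: val_inj; exact: (linearP i a r s). Qed.

Let f_monoid : monoid_morphism f.
Proof.
split=> [|r s]; apply: val_inj; [exact: (rmorph1 i) | exact: (rmorphM i r s)].
Qed.

HB.instance Definition _ := GRing.isLinear.Build k R B _ f f_linear.
HB.instance Definition _ := GRing.isMonoidMorphism.Build R B f f_monoid.

(** The elements satisfying [P] form a subalgebra [B]. The universal map from A to [B], followed by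
    the inclusion, fixes the generators, so by uniqueness it is the identity. *)
Lemma ambiskew_generated x : P x.
Proof.
have [[relp relm relpm] univ] := A_ambiskew.
have [|g [[gi gp gm] _]] := univ B f (exist _ Xp (asboolT P_Xp)) (exist _ Xm (asboolT P_Xm)).
  split=> [r|r|]; apply: val_inj.
  - exact: relp.
  - exact: relm.
  - exact: relpm.
have [g0 [_ uniq]] := univ A i Xp Xm A_ambiskew.1.
have idE := uniq idfun (And3 (frefl _) (erefl _) (erefl _)).
pose G0 u := sval (g u).
have G0_linear : linear G0 by move=> a u v; rewrite /G0 linearP.
have G0_monoid : monoid_morphism G0 by split=> [|u v]; rewrite /G0 ?rmorph1 ?rmorphM.
pose G : {lrmorphism A -> A} := HB.pack G0
  (GRing.isLinear.Build k A A _ G0 G0_linear) (GRing.isMonoidMorphism.Build A A G0 G0_monoid).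
have GE : G =1 g0.
  by apply: uniq; split=> [r||]; rewrite /G /= /G0 ?gp ?gm //; have /= -> := gi r.
rewrite -[x]/(idfun x) idE -GE; exact/asboolP/(valP (g x)).
Qed.

End Generation.

(** * The endomorphism algebra of the coefficient space *)

Section LinearEndomorphisms.
Variables (k : fieldType) (R : algType k).
Local Notation M := (nat -> nat -> R).

Definition linear_pred : {pred M -> M} := fun f => `[<linear f>].

Lemma linear_pred_closed : GRing.submod_closed linear_pred.
Proof.
split=> [|b u v /asboolP u_lin /asboolP v_lin]; apply/asboolP => a x y.
  by rewrite /= addr0 scaler0.
have -> f g z : (b *: f + g : M -> M) z = b *: f z + g z by [].
by rewrite u_lin v_lin !scalerDr !scalerA mulrC addrACA.
Qed.

(** Made into an algebra to serve as a target for the universal property of A. Families in the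
    coefficient space carry no support condition. *)
Definition endo := {f : M -> M | f \in linear_pred}.
HB.instance Definition _ := SubType.on endo.
HB.instance Definition _ := Choice.on endo.
HB.instance Definition _ :=
  GRing.SubChoice_isSubLmodule.Build k (M -> M) linear_pred endo linear_pred_closed.

Definition mk_endo (f : M -> M) (fP : linear f) : endo := exist _ f (asboolT fP).

Lemma endo_linear (f : endo) : linear (val f).
Proof. exact/asboolP/(valP f). Qed.

HB.instance Definition _ (f : endo) :=
  GRing.isLinear.Build k M M _ (val f) (endo_linear f).

Lemma endo_id_linear : linear (id : M -> M). Proof. by []. Qed.
Lemma endo_comp_linear (f g : endo) : linear (val f \o val g).
Proof.
by move=> a x y; exact: etrans (congr1 (val f) (endo_linear g a x y)) (endo_linear f _ _ _).
Qed.

Definition endo_one := mk_endo endo_id_linear.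
Definition endo_mul (f g : endo) := mk_endo (endo_comp_linear f g).

Lemma endo_ext (f g : endo) : val f =1 val g -> f = g.
Proof. by move=> fg; apply: val_inj; apply/funext. Qed.

Lemma endo_scale_add a (f g : endo) x m n :
  val (a *: f + g) x m n = a *: val f x m n + val g x m n.
Proof. by []. Qed.

Lemma endo_mulA : associative endo_mul. Proof. by move=> f g u; exact: endo_ext. Qed.
Lemma endo_mul1 : left_id endo_one endo_mul. Proof. by move=> f; exact: endo_ext. Qed.
Lemma endo_mulr1 : right_id endo_one endo_mul. Proof. by move=> f; exact: endo_ext. Qed.
Lemma endo_mulDl : left_distributive endo_mul +%R.
Proof. by move=> f g u; exact: endo_ext. Qed.
Lemma endo_mulDr : right_distributive endo_mul +%R.
Proof. by move=> f g u; apply: endo_ext => x; have := endo_linear f 1 (val g x) (val u x); rewrite !scale1r. Qed.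
Lemma endo_one_neq0 : endo_one != 0.
Proof.
apply/eqP => /(congr1 (fun f : endo => val f (fun _ _ => 1) 0%N 0%N)) /eqP.
by rewrite oner_eq0.
Qed.

HB.instance Definition _ := GRing.Zmodule_isNzRing.Build endo
  endo_mulA endo_mul1 endo_mulr1 endo_mulDl endo_mulDr endo_one_neq0.

Lemma endo_scaleAl (a : k) (f g : endo) : a *: (f * g) = a *: f * g.
Proof. exact: endo_ext. Qed.
HB.instance Definition _ := GRing.Lmodule_isLalgebra.Build k endo endo_scaleAl.

Lemma endo_scaleAr (a : k) (f g : endo) : a *: (f * g) = f * (a *: g).
Proof.
apply: endo_ext => x; have := endo_linear f a (val g x) 0.
have /(_ 0 0) := endo_linear f (-1); rewrite scaler0 addr0 scaleN1r addNr => ->.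
by rewrite !addr0. Qed.
HB.instance Definition _ := GRing.Lalgebra_isAlgebra.Build k endo endo_scaleAr.

End LinearEndomorphisms.

(** * A module satisfying the ambiskew relations *)

Section AmbiskewModel.
Variables (k : fieldType) (R : algType k) (sigma sigmaV : {lrmorphism R -> R}).
Hypotheses (sigmaK : cancel sigma sigmaV) (sigmaVK : cancel sigmaV sigma).
Variable h : R.
Hypothesis h_central : forall r : R, h * r = r * h.
Variable xi : k.
Hypothesis xi_neq0 : xi != 0.
Local Notation M := (nat -> nat -> R).

(* X- X+^m = xi^-m X+^m X- - (twist m) X+^(m-1). *)
Fixpoint twist (m : nat) : R := if m is m'.+1 then xi^-1 *: (sigma (twist m') + h) else 0.

(* The action of r, X+ and X- on formal sums of the f m n X+^m X-^n. *)
Definition left_op (r : R) (f : M) : M := fun m n => r * f m n.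
Definition plus_op (f : M) : M := fun m n => if m is m'.+1 then sigma (f m' n) else 0.
Definition minus_op (f : M) : M := fun m n =>
  (if n is n'.+1 then xi ^- m *: sigmaV (f m n') else 0) - sigmaV (f m.+1 n) * twist m.+1.

Lemma scale_addE a (f g : M) m n : (a *: f + g) m n = a *: f m n + g m n.
Proof. by []. Qed.

Lemma left_op_linear r : linear (left_op r).
Proof.
move=> a f g; apply/funext => m; apply/funext => n.
by rewrite scale_addE /left_op scale_addE mulrDr -scalerAr.
Qed.

Lemma plus_op_linear : linear plus_op.
Proof.
move=> a f g; apply/funext => m; apply/funext => n; rewrite scale_addE /plus_op.
by case: m => [|m]; rewrite ?scaler0 ?addr0 // scale_addE linearP.
Qed.

Lemma minus_op_linear : linear minus_op.
Proof.
move=> a f g; apply/funext => m; apply/funext => n; rewrite scale_addE /minus_op.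
rewrite !scale_addE !linearP mulrDl scalerBr -scalerAl opprD addrACA; congr (_ + _).
case: n => [|n]; first by rewrite scaler0 addr0.
by rewrite scale_addE linearP scalerDr !scalerA mulrC.
Qed.

Definition left_endo r : endo R := mk_endo (left_op_linear r).

Lemma left_endo_linear : linear left_endo.
Proof.
move=> a r s; apply: endo_ext => f; apply/funext => m; apply/funext => n.
rewrite endo_scale_add -[LHS]/((a *: r + s) * f m n) mulrDl -scalerAl.
by [].
Qed.

Lemma left_endo_monoid : monoid_morphism left_endo.
Proof.
split=> [|r s]; apply: endo_ext => f; apply/funext => m; apply/funext => n.
  by rewrite /= /left_op mul1r.
by rewrite /= /left_op mulrA.
Qed.

HB.instance Definition _ := GRing.isLinear.Build k R (endo R) _ left_endo left_endo_linear.
HB.instance Definition _ :=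
  GRing.isMonoidMorphism.Build R (endo R) left_endo left_endo_monoid.

(** The recursion for [twist], that is xi twist(m+1) = sigma(twist m) + h, is what the relation for
    X+ X- demands of the coefficients. *)
Lemma ambiskew_model : ambiskew_relations sigma sigmaV h xi left_endo
  (mk_endo plus_op_linear) (mk_endo minus_op_linear).
Proof.
split=> [r|r|]; apply: endo_ext => f; apply/funext => m; apply/funext => n.
- by rewrite /= /plus_op /left_op; case: m => [|m]; rewrite ?mulr0 ?rmorphM.
- rewrite /= /minus_op /left_op mulrBr !rmorphM mulrA; congr (_ - _).
  by case: n => [|n]; rewrite ?mulr0 // rmorphM scalerAr.
transitivity (h * f m n + xi *: minus_op (plus_op f) m n); last by [].
transitivity (plus_op (minus_op f) m n); first by [].
(* At m = 0 the side of X+ X- is 0, and [twist 1] = xi^-1 h makes the other side cancel. *)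
rewrite /minus_op /plus_op; case: m => [|m].
  have -> : xi *: ((if n is n'.+1 then xi ^- 0 *: sigmaV 0 else 0)
      - sigmaV (sigma (f 0%N n)) * twist 1) = - (h * f 0%N n).
    rewrite [X in X - _](_ : _ = 0); last by case: n => // n; rewrite rmorph0 scaler0.
    rewrite add0r scalerN sigmaK /= rmorph0 add0r -scalerAr scalerA mulfV // scale1r.
    by rewrite h_central.
  by rewrite subrr.
rewrite sigmaK rmorphB rmorphM /= sigmaVK scalerBr addrCA.
have -> : xi *: (f m.+1 n * twist m.+2) = f m.+1 n * sigma (twist m.+1) + h * f m.+1 n.
  rewrite scalerAr [twist m.+2]/= scalerA mulfV // scale1r.
  by rewrite mulrDr h_central.
rewrite opprD [- _ - _]addrC addNKr; congr (_ - _).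
case: n => [|n]; first by rewrite rmorph0 scaler0.
rewrite linearZ /= sigmaVK sigmaK scalerA; congr (_ *: _).
by rewrite exprS invfM mulrA mulfV // mul1r.
Qed.

End AmbiskewModel.

(** * The PBW basis *)

Section PBW.
Variables (k : fieldType) (R A : algType k) (sigma sigmaV : {lrmorphism R -> R}).
Hypotheses (sigmaK : cancel sigma sigmaV) (sigmaVK : cancel sigmaV sigma).
Variable h : R.
Hypothesis h_central : forall r : R, h * r = r * h.
Variable xi : k.
Hypothesis xi_neq0 : xi != 0.
Variables (i : {lrmorphism R -> A}) (Xp Xm : A).
Hypothesis A_ambiskew : is_ambiskew sigma sigmaV h xi i Xp Xm.

(** [pi m n x] is the (m, n) coefficient of [x] applied to the vector of 1 in the model; r X+^j X-^l
    sends that vector to r in position (j, l). *)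
Lemma pbw_coordinates : exists pi : nat -> nat -> {linear A -> R},
  forall m n r j l, pi m n (i r * Xp ^+ j * Xm ^+ l) = if (m == j) && (n == l) then r else 0.
Proof.
have model := ambiskew_model sigmaK sigmaVK h_central xi_neq0.
have [g [[gi gp gm] _]] := A_ambiskew.2 _ _ _ _ model.
pose delta (r : R) j l : nat -> nat -> R :=
  fun m n => if (m == j) && (n == l) then r else 0.
pose c m n x := val (g x) (delta 1 0%N 0%N) m n.
have c_linear m n : linear (c m n).
  by move=> a x y; rewrite /c linearP.
pose C m n : {linear A -> R} :=
  HB.pack (c m n) (GRing.isLinear.Build k A R _ (c m n) (c_linear m n)).
exists C.
move=> m n r j l; rewrite -[LHS]/(c m n _) /c.
have gM x y : g (x * y) = g x * g y by rewrite rmorphM.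
(* The powers of X- act first, on vectors without X+, so the [twist] term vanishes. *)
have gml : val (g (Xm ^+ l)) (delta 1 0%N 0%N) = delta 1 0%N l.
  elim: l => [|l IHl]; first by rewrite expr0 rmorph1.
  rewrite exprS gM gm -[LHS]/(minus_op _ _ _ _ (val (g (Xm ^+ l)) _)) IHl.
  apply/funext => a; apply/funext => b; rewrite /minus_op /delta /= rmorph0 mul0r subr0.
  case: b => [|b]; first by rewrite andbF.
  rewrite eqSS; case: eqP => [->|_] /=; last by rewrite rmorph0 scaler0.
  by case: eqP => _; rewrite ?rmorph1 ?rmorph0 ?scaler0 // expr0 invr1 scale1r.
have gpj : val (g (Xp ^+ j * Xm ^+ l)) (delta 1 0%N 0%N) = delta 1 j l.
  elim: j => [|j IHj]; first by rewrite expr0 mul1r.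
  rewrite exprS -mulrA gM gp -[LHS]/(plus_op _ (val (g (_ * _)) _)) IHj.
  apply/funext => a; apply/funext => b; rewrite /plus_op /delta.
  by case: a => [|a] //; rewrite eqSS; case: ifP => _; rewrite ?rmorph1 ?rmorph0.
rewrite -mulrA gM; have /= -> := gi r.
rewrite -[LHS]/(left_op r (val (g (_ * _)) _) m n) gpj /left_op /delta.
by case: ifP => _; rewrite ?mulr1 ?mulr0.
Qed.

(** The elements [y] for which left multiplication preserves the span form a subalgebra; it contains
    the generators, hence [x], and x = x 1. *)
Lemma pbw_span x : lspan [set y | exists m n r, y = i r * Xp ^+ m * Xm ^+ n] x.
Proof.
have [[relp relm relpm] _] := A_ambiskew.
set S := lspan _; have sS : subspace S := lspan_subspace _.
have Smono m n r : S (i r * Xp ^+ m * Xm ^+ n) by apply: sub_lspan; exists m, n, r.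
pose P y := forall s, S s -> S (y * s).
have PmulP y : (forall m n r, S (y * (i r * Xp ^+ m * Xm ^+ n))) -> P y.
  move=> Sy s Ss.
  have mul_linear : linear ( *%R y) by move=> a u v; rewrite mulrDr -scalerAr.
  pose mul : {linear A -> A} := HB.pack ( *%R y) (GRing.isLinear.Build k A A _ _ mul_linear).
  apply: (lspan_sub (subspace_preimage mul sS)) Ss => _ [m [n [r ->]]].
  exact: Sy.
have P_R r : P (i r).
  by apply: PmulP => m n s; rewrite !mulrA -rmorphM; exact: Smono.
have P_Xp : P Xp.
  apply: PmulP => m n s; rewrite !mulrA relp -(mulrA _ Xp) -exprS; exact: Smono.
suff Px : P x.
  by rewrite -[x]mulr1; apply: Px; have := Smono 0%N 0%N 1; rewrite rmorph1 !mulr1.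
apply: (ambiskew_generated A_ambiskew (P := P)) => //.
- move=> a y z Py Pz s Ss; rewrite mulrDl -scalerAl; apply: sS.2; [exact: Py | exact: Pz].
- by move=> y z Py Pz s Ss; rewrite -mulrA; apply: Py; exact: Pz.
apply: PmulP => m n r; rewrite !mulrA relm -!mulrA; apply: P_R.
(* X- moves right through X+^m one factor at a time, by X- X+ = xi^-1 (X+ X- - h). *)
elim: m => [|m IHm].
  by rewrite mul1r -exprS; have := Smono 0%N n.+1 1; rewrite rmorph1 !mul1r.
have XmXp : Xm * Xp = xi^-1 *: (Xp * Xm - i h).
  by rewrite relpm addrC addKr scalerA mulVf // scale1r.
rewrite exprS !mulrA XmXp -!scalerAl; apply: (subspaceZ _ sS).
rewrite !mulrBl; apply: (subspaceB sS); last exact: Smono.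
by rewrite -!mulrA; exact: P_Xp.
Qed.

Lemma pbw_linear_ext (V : lmodType k) (f g : {linear A -> V}) :
  (forall m n r, f (i r * Xp ^+ m * Xm ^+ n) = g (i r * Xp ^+ m * Xm ^+ n)) -> f =1 g.
Proof.
move=> fg x; apply/eqP; rewrite -subr_eq0; apply/eqP.
apply: (lspan_sub (subspace_preimage (f \- g) (@subspace0 k V))) (pbw_span x).
by move=> _ [m [n [r ->]]] /=; rewrite fg subrr.
Qed.

Lemma pbw_decomposition (pi : nat -> nat -> {linear A -> R}) :
  (forall m n r j l, pi m n (i r * Xp ^+ j * Xm ^+ l) = if (m == j) && (n == l) then r else 0) ->
  forall x, exists N, x = \sum_(m < N) \sum_(n < N) i (pi m n x) * Xp ^+ m * Xm ^+ n.
Proof.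
move=> piE x.
(* Allowing all larger bounds lets two elements share one, so that [Q] is a subspace. *)
pose Q y := exists N, forall N', (N <= N')%N ->
  y = \sum_(m < N') \sum_(n < N') i (pi m n y) * Xp ^+ m * Xm ^+ n.
suff [N NP] : Q x by exists N; exact: NP.
have sQ : subspace Q.
  split=> [|a u v [N uN] [N' vN']].
    exists 0%N => N' _; rewrite big1 // => m _; rewrite big1 // => n _.
    by rewrite linear0 rmorph0 !mul0r.
  exists (maxn N N') => p; rewrite geq_max => /andP[Np N'p].
  rewrite {1}(uN p Np) {1}(vN' p N'p) scaler_sumr -big_split; apply: eq_bigr => m _.
  rewrite scaler_sumr -big_split; apply: eq_bigr => n _ /=.
  by rewrite linearP linearP !mulrDl -!scalerAl.
apply: (lspan_sub sQ) (pbw_span x) => _ [j [l [r ->]]].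
exists (maxn j l).+1 => N; rewrite gtn_max => /andP[jN lN].
rewrite (bigD1 (Ordinal jN)) //= (bigD1 (Ordinal lN)) //= piE !eqxx.
rewrite [X in _ = _ + X + _]big1 => [|n]; last first.
  by rewrite -val_eqE /= piE => /negPf ->; rewrite andbF rmorph0 !mul0r.
rewrite big1 ?addr0 // => m; rewrite -val_eqE /= => /negPf mj.
by rewrite big1 // => n _; rewrite piE mj rmorph0 !mul0r.
Qed.

End PBW.

(** * Translation by grouplike elements *)

Section GrouplikeTranslation.
Variables (k : fieldType) (R : hopfAlgType k).

Lemma comulM (x y : R) : comul (x * y) = comul x * comul y.
Proof. by have [_ ->] := @comul_monoid_morphism k R. Qed.

Lemma comul1 : comul (1 : R) = 1.
Proof. by have [-> _] := @comul_monoid_morphism k R. Qed.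

Lemma comulXn (x : R) n : comul (x ^+ n) = comul x ^+ n.
Proof. by elim: n => [|n IHn]; rewrite ?expr0 ?comul1 // !exprS comulM IHn. Qed.

Lemma counit1 : counit (1 : R) = 1.
Proof. by have [-> _] := @counit_monoid_morphism k R. Qed.

(** The inverse is the antipode of [y]; its coproduct and its tensor square both invert y (x) y. *)
Lemma grouplike_inverse (y : R) : grouplike y ->
  exists z, [/\ y * z = 1, z * y = 1 & comul z = z \ox z].
Proof.
move=> [yy y1]; exists (antipode y).
have zy : antipode y * y = 1.
  have := antipodel y; rewrite yy y1 scale1r tlift_tens //.
  split=> [c a b b'|c a b b'] /=; first by rewrite linearP mulrDl scalerAl.
  by rewrite mulrDr scalerAr.
have yz : y * antipode y = 1.
  have := antipoder y; rewrite yy y1 scale1r tlift_tens //.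
  split=> [c a b b'|c a b b'] /=; first by rewrite mulrDl scalerAl.
  by rewrite linearP mulrDr scalerAr.
have oneE : 1 = (y \ox y) * (antipode y \ox antipode y) by rewrite tensM yz.
by split=> //; rewrite -[LHS]mulr1 oneE mulrA -yy -comulM zy comul1 mul1r.
Qed.

Definition right_translation (y r : R) : R := r * y.

Lemma right_translation_linear y : linear (right_translation y).
Proof. by move=> a r s; rewrite /right_translation mulrDl scalerAl. Qed.

HB.instance Definition _ y :=
  GRing.isLinear.Build k R R _ (right_translation y) (right_translation_linear y).

(** Right multiplication by a grouplike respects [comul] and is inverted by another such map, so
    [coradical_filtration_image] applies both ways. *)
Lemma coradical_filtration_translate y n r : grouplike y ->
  coradical_filtration R n (r * y) <-> coradical_filtration R n r.
Proof.
move=> gy; have [z [yz zy zz]] := grouplike_inverse gy.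
have transl u v : comul u = u \ox u -> u * v = 1 -> forall s,
    coradical_filtration R n s -> coradical_filtration R n (s * u).
  move=> uu uv; apply: (coradical_filtration_image (phi := right_translation u)
    (rho := right_translation v)) => [s|s]; last first.
    by rewrite /= /right_translation -mulrA uv mulr1.
  rewrite -[LHS]/(comul (s * u)) comulM uu.
  move: (comul s); apply: tensor_ext => [a x x'|a x x'|b c].
  - by rewrite mulrDl tensor_scaleAl.
  - exact: linearP.
  - by rewrite tensM tmapE.
split; last by apply: (transl y z) => //; case: gy.
by move=> /(transl z y zz zy); rewrite -mulrA yz mulr1.
Qed.

End GrouplikeTranslation.

(** * The coproduct in PBW coordinates *)

Section AmbiskewHopf.
Variables (k : fieldType) (R A : hopfAlgType k).
Variables (sigma sigmaV : {lrmorphism R -> R}).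
Hypotheses (sigmaK : cancel sigma sigmaV) (sigmaVK : cancel sigmaV sigma).
Variables (h : R) (xi : k) (xi_neq0 : xi != 0).
Variables (i : {lrmorphism R -> A}) (Xp Xm : A).
Hypothesis A_ambiskew : is_ambiskew sigma sigmaV h xi i Xp Xm.
Hypothesis comul_i : forall r, comul (i r) = tmap i i (comul r).
Variables (yp ym : R).
Hypotheses (yp_grouplike : grouplike yp) (ym_grouplike : grouplike ym).
Hypothesis comul_Xp : comul Xp = Xp \ox 1 + i yp \ox Xp.
Hypothesis comul_Xm : comul Xm = Xm \ox 1 + i ym \ox Xm.
Variable pi : nat -> nat -> {linear A -> R}.
Hypothesis piE : forall m n r j l,
  pi m n (i r * Xp ^+ j * Xm ^+ l) = if (m == j) && (n == l) then r else 0.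

Definition monomial j l (r : R) : A := i r * Xp ^+ j * Xm ^+ l.

Lemma monomial_linear j l : linear (monomial j l).
Proof. by move=> a r s; rewrite /monomial linearP !mulrDl -!scalerAl. Qed.

HB.instance Definition _ j l :=
  GRing.isLinear.Build k R A _ (monomial j l) (monomial_linear j l).

Lemma pi_monomial m n j l r :
  pi m n (monomial j l r) = if (m == j) && (n == l) then r else 0.
Proof. exact: piE. Qed.

Lemma monomial00 r : monomial 0 0 r = i r.
Proof. by rewrite /monomial !mulr1. Qed.

Lemma iK : cancel i (pi 0 0).
Proof. by move=> r; rewrite -monomial00 pi_monomial. Qed.

(* Comparing the two components X+ (x) X- and X- (x) X+ of the comultiplication *)
(* of the relation X+ X- = h + xi X- X+.                                        *)
Lemma sigma_grouplike : sigma yp = xi *: yp /\ sigma ym = xi *: ym.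
Proof.
have [[relp relm relpm] _] := A_ambiskew.
(* Acting by [g] on the relation keeps only the terms with X+ or X- as right tensor factor. *)
have lactM (g : {scalar A}) : (forall r, g (i r) = 0) -> g (Xp * Xm) = 0 ->
    g Xm *: (Xp * i ym) + g Xp *: (i yp * Xm)
    = xi *: (g Xp *: (Xm * i yp) + g Xm *: (i ym * Xp)).
  move=> gi gpm.
  have g1 : g 1 = 0 by rewrite -(rmorph1 i) gi.
  have gmp : g (Xm * Xp) = 0.
    by have := congr1 g relpm; rewrite gpm linearD gi add0r linearZ /= => /esym/eqP;
      rewrite mulf_eq0 (negPf xi_neq0) => /eqP.
  have := congr1 (lact g) relpm; rewrite linearD linearZ /=.
  rewrite (lact_comorphism comul_i) [lact (g \o i) h](_ : _ = 0); last first.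
    by apply: big1 => p _ /=; rewrite gi scale0r.
  rewrite linear0 add0r /lact !comulM comul_Xp comul_Xm !mulrDl !mulrDr !tensM.
  rewrite !linearD /= !contractrE !mulr1 !mul1r g1 gpm gmp !scale0r !add0r !addr0.
  by rewrite !scaler0 !add0r !addr0.
pose g m n : {scalar A} := counit \o pi m n.
have gE m n j l r : g m n (i r * Xp ^+ j * Xm ^+ l) = if (m == j) && (n == l) then counit r else 0.
  by rewrite /= piE; case: ifP; rewrite ?linear0.
have gi m n r : g m n (i r) = if (m == 0%N) && (n == 0%N) then counit r else 0.
  by rewrite -gE !mulr1.
have gp m n : g m n Xp = ((m == 1%N) && (n == 0%N))%:R.
  by have := gE m n 1%N 0%N 1; rewrite rmorph1 mul1r mulr1 => ->; rewrite counit1; case: ifP.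
have gm m n : g m n Xm = ((m == 0%N) && (n == 1%N))%:R.
  by have := gE m n 0%N 1%N 1; rewrite rmorph1 !mul1r => ->; rewrite counit1; case: ifP.
have gpm m n : g m n (Xp * Xm) = ((m == 1%N) && (n == 1%N))%:R.
  by have := gE m n 1%N 1%N 1; rewrite rmorph1 mul1r => ->; rewrite counit1; case: ifP.
have piXp r : pi 1 0 (i r * Xp) = r by have := piE 1 0 r 1 0; rewrite expr0 expr1 mulr1.
have piXm r : pi 0 1 (i r * Xm) = r by have := piE 0 1 r 0 1; rewrite expr0 expr1 mulr1.
split.
  have := lactM (g 1%N 0%N) (fun r => gi _ _ r) (gpm _ _).
  rewrite gp gm /= !scale0r !scale1r add0r addr0 relm => /(congr1 (pi 0 1)).
  by rewrite linearZ /= !piXm => {1}->; rewrite linearZ /= sigmaVK.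
have := lactM (g 0%N 1%N) (fun r => gi _ _ r) (gpm _ _).
rewrite gp gm /= !scale0r !scale1r add0r addr0 relp => /(congr1 (pi 1 0)).
by rewrite linearZ /= !piXp.
Qed.

(** The coefficient of the term with X+^j X-^l on the right in the coproduct of X+^m X-^n; the power
    of [xi] comes from moving ym^l left past X+^(m-j). *)
Definition comul_coef m n j l : k :=
  qbinomial xi m j * qbinomial xi^-1 n l * xi ^+ ((m - j) * l).

Lemma Xp_ymX m l : Xp ^+ m * i ym ^+ l = xi ^+ (m * l) *: (i ym ^+ l * Xp ^+ m).
Proof.
have [[relp relm relpm] _] := A_ambiskew; have [_ ymE] := sigma_grouplike.
have XY : Xp * i ym = xi *: (i ym * Xp) by rewrite relp ymE linearZ scalerAl.
elim: m => [|m IHm]; first by rewrite mul0n !expr0 mul1r mulr1 scale1r.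
rewrite exprS -mulrA IHm -scalerAr [Xp * (_ * _)]mulrA (qcomm_exp l XY) -scalerAl scalerA.
by rewrite -exprD mulSn addnC -mulrA -exprS.
Qed.

Lemma tens_comul_expr (a b : A) m n :
  a \ox b * comul (Xp ^+ m) * comul (Xm ^+ n) =
  \sum_(j < m.+1) \sum_(l < n.+1) comul_coef m n j l *:
    ((a * i (yp ^+ j * ym ^+ l) * Xp ^+ (m - j) * Xm ^+ (n - l)) \ox (b * Xp ^+ j * Xm ^+ l)).
Proof.
have [[relp relm relpm] _] := A_ambiskew; have [ypE ymE] := sigma_grouplike.
have XYp : Xp * i yp = xi *: (i yp * Xp) by rewrite relp ypE linearZ scalerAl.
have XYm : Xm * i ym = xi^-1 *: (i ym * Xm).
  rewrite relm (_ : sigmaV ym = xi^-1 *: ym) ?linearZ ?scalerAl //.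
  by rewrite -[in RHS](sigmaK ym) ymE linearZ /= scalerA mulVf // scale1r.
rewrite !comulXn comul_Xp comul_Xm (qbinomial_expr m XYp) (qbinomial_expr n XYm).
rewrite [a \ox b * _]mulr_sumr mulr_suml; apply: eq_bigr => j _.
rewrite mulr_sumr; apply: eq_bigr => l _.
rewrite !tensor_scaleAr tensor_scaleAl scalerA !tensM [qbinomial xi^-1 _ _ * _]mulrC.
rewrite rmorphM !rmorphXn.
have -> : a * (i yp ^+ j * Xp ^+ (m - j)) * (i ym ^+ l * Xm ^+ (n - l))
    = xi ^+ ((m - j) * l) *: (a * (i yp ^+ j * i ym ^+ l) * Xp ^+ (m - j) * Xm ^+ (n - l)).
  rewrite !mulrA -(mulrA _ (Xp ^+ _) (i ym ^+ _)) Xp_ymX -!scalerAr -!scalerAl.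
  by rewrite !mulrA.
by rewrite tensZl scalerA /comul_coef.
Qed.

Lemma lact_monomial (g : {scalar A}) m n r :
  lact g (monomial m n r) =
  \sum_(j < m.+1) \sum_(l < n.+1) comul_coef m n j l *:
    monomial (m - j) (n - l) (lact (g \o monomial j l) r * (yp ^+ j * ym ^+ l)).
Proof.
rewrite /lact {1}/monomial !comulM comul_i; move: (comul r).
apply: tensor_ext => [a x y|a x y|b c].
- by rewrite linearP !mulrDl !tensor_scaleAl linearP.
- rewrite scaler_sumr -big_split; apply: eq_bigr => j _.
  rewrite scaler_sumr -big_split; apply: eq_bigr => l _ /=.
  by rewrite linearP mulrDl -scalerAl linearP scalerDr !scalerA [a * _]mulrC.
rewrite tmapE tens_comul_expr linear_sum; apply: eq_bigr => j _.
rewrite linear_sum; apply: eq_bigr => l _ /=.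
rewrite linearZ /= !contractrE /= -scalerAl [monomial _ _ _]linearZ /=.
by rewrite [monomial (m - j) _ _]/monomial (rmorphM i b).
Qed.

Lemma lact_monomial_coordinate (f : {scalar R}) j l j' l' r :
  lact ((f \o pi j l) \o monomial j' l') r = if (j == j') && (l == l') then lact f r else 0.
Proof.
case: ifP => [jl|jl]; first by apply: eq_lact => s /=; rewrite pi_monomial jl.
by apply: big1 => p _ /=; rewrite pi_monomial jl linear0 scale0r.
Qed.

(** In [lact_monomial] only the term with exponents (j, l) survives a functional factoring through
    [pi j l], which therefore lowers the bidegree by (j, l). *)
Lemma lact_coordinate (f : {scalar R}) m n j l x :
  pi m n (lact (f \o pi j l) x) =
  comul_coef (m + j) (n + l) j l *: (lact f (pi (m + j) (n + l) x) * (yp ^+ j * ym ^+ l)).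
Proof.
pose y := yp ^+ j * ym ^+ l.
apply: (pbw_linear_ext xi_neq0 A_ambiskew
  (f := pi m n \o lact (f \o pi j l))
  (g := comul_coef (m + j) (n + l) j l \*: (right_translation y \o lact f \o pi (m + j) (n + l)))).
move=> p q r; rewrite -/(monomial p q r) /= pi_monomial lact_monomial linear_sum.
transitivity (\sum_(j' < p.+1) \sum_(l' < q.+1)
    if (j == j') && (l == l') && (m + j == p)%N && (n + l == q)%N
    then comul_coef p q j l *: (lact f r * y) else 0).
  apply: eq_bigr => j' _; rewrite linear_sum; apply: eq_bigr => l' _.
  rewrite linearZ /= lact_monomial_coordinate pi_monomial.
  case: (j =P j') => [jj'|_] /=; last by case: ifP; rewrite ?mul0r ?scaler0.
  case: (l =P l') => [ll'|_] /=; last by case: ifP; rewrite ?mul0r ?scaler0.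
  have jp : (j <= p)%N by rewrite jj' -ltnS.
  have lq : (l <= q)%N by rewrite ll' -ltnS.
  rewrite -jj' -ll' -(eqn_add2r j m) subnK // -(eqn_add2r l n) subnK //.
  by case: ifP; rewrite ?scaler0.
have [pE|pN] := eqVneq (m + j)%N p; last first.
  rewrite big1 => [|j' _]; first by rewrite /= ?andbF ?linear0 ?scaler0 ?linear0 ?scaler0.
  by rewrite big1 // => l' _; rewrite andbF.
have [qE|qN] := eqVneq (n + l)%N q; last first.
  rewrite big1 => [|j' _]; first by rewrite /= ?andbF ?linear0 ?scaler0 ?linear0 ?scaler0.
  by rewrite big1 // => l' _; rewrite andbF.
have jp : (j < p.+1)%N by rewrite ltnS -pE leq_addl.
have lq : (l < q.+1)%N by rewrite ltnS -qE leq_addl.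
rewrite (bigD1 (Ordinal jp)) //= (bigD1 (Ordinal lq)) //= !eqxx /=.
rewrite [X in _ + X + _]big1 => [|l']; last first.
  by rewrite -val_eqE eq_sym /= => /negPf ->.
rewrite big1 => [|j']; last first.
  by rewrite -val_eqE eq_sym /= => /negPf jj'; rewrite big1 // => l' _; rewrite jj'.
by rewrite !addr0 pE qE.
Qed.

(** * The candidate filtration *)

Hypothesis chark0 : [pchar k] =i pred0.

Lemma grouplike_ypym j l : grouplike (yp ^+ j * ym ^+ l).
Proof.
have counitM (x y : R) : counit (x * y) = counit x * counit y.
  by have [_ ->] := @counit_monoid_morphism k R.
have glM (x y : R) : grouplike x -> grouplike y -> grouplike (x * y).
  move=> [xx x1] [yy y1]; split; first by rewrite comulM xx yy tensM.
  by rewrite counitM x1 y1 mulr1.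
have glX (x : R) n : grouplike x -> grouplike (x ^+ n).
  move=> gx; elim: n => [|n IHn]; last by rewrite exprS; exact: glM.
  by rewrite expr0; split; [rewrite comul1 | rewrite counit1].
by apply: glM; exact: glX.
Qed.

Lemma mul_ypym_eq0 r j l : (r * (yp ^+ j * ym ^+ l) == 0) = (r == 0).
Proof.
have [z [yz _ _]] := grouplike_inverse (grouplike_ypym j l).
apply/eqP/eqP => [r0|->]; last by rewrite mul0r.
by rewrite -[r]mulr1 -yz mulrA r0 mul0r.
Qed.

(** Level t - a of R, read as 0 when a > t, where truncated subtraction would give the coradical. *)
Definition shifted_filtration t a : set R :=
  if (a <= t)%N then coradical_filtration R (t - a) else [set 0].

Lemma shifted_filtration_subspace t a : subspace (shifted_filtration t a).
Proof.
rewrite /shifted_filtration; case: ifP => _; last exact: subspace0.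
exact: coradical_filtration_subspace.
Qed.

Lemma shifted_filtration_translate t a r j l :
  shifted_filtration t a (r * (yp ^+ j * ym ^+ l)) <-> shifted_filtration t a r.
Proof.
rewrite /shifted_filtration; case: ifP => _.
  exact: coradical_filtration_translate (grouplike_ypym j l).
split=> [/= r0|/= ->]; last by rewrite mul0r.
by apply/eqP; rewrite -(mul_ypym_eq0 r j l) r0.
Qed.

Definition pbw_filtration t : set A :=
  [set x | forall m n, shifted_filtration t (hat xi m + hat xi n) (pi m n x)].

Lemma pbw_filtration_subspace t : subspace (pbw_filtration t).
Proof.
split=> [m n|a u v Fu Fv m n]; first by rewrite linear0; exact: (shifted_filtration_subspace _ _).1.
by rewrite linearP; apply: (shifted_filtration_subspace _ _).2; [exact: Fu | exact: Fv].
Qed.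

Lemma pbw_filtration_monomial t m n r :
  shifted_filtration t (hat xi m + hat xi n) r -> pbw_filtration t (monomial m n r).
Proof.
move=> Fr p q; rewrite pi_monomial; case: ifP => [/andP[/eqP-> /eqP->] //|_].
exact: (shifted_filtration_subspace _ _).1.
Qed.

Lemma pbw_sum x : exists N, x = \sum_(m < N) \sum_(n < N) monomial m n (pi m n x).
Proof. exact: (pbw_decomposition xi_neq0 A_ambiskew piE). Qed.

Lemma pi_ext x y : (forall m n, pi m n x = pi m n y) -> x = y.
Proof.
move=> xy; apply/eqP; rewrite -subr_eq0; have [N ->] := pbw_sum (x - y); apply/eqP.
rewrite big1 // => m _; rewrite big1 // => n _.
by rewrite linearB /= xy subrr linear0.
Qed.

Lemma pi_finite_support x : exists N, forall m n, (N <= m + n)%N -> pi m n x = 0.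
Proof.
pose Q y := exists N, forall m n, (N <= m + n)%N -> pi m n y = 0.
have sQ : subspace Q.
  split=> [|a u v [N uN] [N' vN']]; first by exists 0%N => m n _; rewrite linear0.
  exists (maxn N N') => m n; rewrite geq_max => /andP[Nmn N'mn].
  by rewrite linearP /= uN // vN' // scaler0 addr0.
apply: (lspan_sub sQ) (pbw_span xi_neq0 A_ambiskew x) => _ [j [l [r ->]]].
exists (j + l).+1 => m n; rewrite piE; case: ifP => // /andP[/eqP-> /eqP->].
by rewrite ltnn.
Qed.

Lemma pbw_filtrationE t : pbw_filtration t =
  lspan [set x : A | exists q m n : nat, exists r : R,
    [/\ (q + hat xi m + hat xi n <= t)%N, coradical_filtration R q r
      & x = i r * Xp ^+ m * Xm ^+ n]].
Proof.
apply/seteqP; split=> [x Fx|].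
  have [N ->] := pbw_sum x.
  apply: subspace_sum => [|m _]; first exact: lspan_subspace.
  apply: subspace_sum => [|n _]; first exact: lspan_subspace.
  have := Fx m n; rewrite /shifted_filtration; case: ifP => [mn Cx|_ ->]; last first.
    by rewrite linear0; exact: (lspan_subspace _).1.
  (* The largest admissible q is taken. *)
  apply: sub_lspan; exists (t - (hat xi m + hat xi n))%N, m, n, (pi m n x); split=> //.
  by rewrite -addnA subnK.
apply: lspan_sub; first exact: pbw_filtration_subspace.
move=> _ [q [m [n [r [qmn Cr ->]]]]]; apply: pbw_filtration_monomial.
have [mn_t q_le] : (hat xi m + hat xi n <= t)%N /\ (q <= t - (hat xi m + hat xi n))%N by lia.
rewrite /shifted_filtration mn_t; exact: coradical_filtration_leq Cr.
Qed.

(** * The coradical of A *)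

Lemma pi_i m n r : pi m n (i r) = if (m == 0%N) && (n == 0%N) then r else 0.
Proof. by rewrite -monomial00 pi_monomial. Qed.

Lemma comul_coef_neq0 m n j l :
  (comul_coef m n j l != 0) = (qbinomial xi m j != 0) && (qbinomial xi^-1 n l != 0).
Proof. by rewrite !mulf_eq0 !negb_or expf_eq0 (negPf xi_neq0) andbF andbT. Qed.

(** Acting on a nonzero element of [D] by the coordinate functional at a support point of maximal
    degree gives a nonzero element of R. So [D] meets the subcoalgebra R and, being simple, lies in
    it. *)
Lemma simple_subcoalgebra_range (D : set A) : simple_subcoalgebra D -> D `<=` range i.
Proof.
move=> [sD D0 minD]; have [sbD cD] := (subcoalgebraP D).1 sD.
have [x Dx x0] : exists2 x, D x & x != 0.
  apply: contrapT => noD; apply: D0; apply/seteqP; split=> [x Dx|_ ->]; last exact: sbD.1.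
  by apply: contrapT => /eqP x0; apply: noD; exists x.
pose supp s := `[< exists m n, (m + n)%N = s /\ pi m n x != 0 >].
have [s0 s0x] : exists s, supp s.
  have [m [n mn]] : exists m n, pi m n x != 0.
    apply: contrapT => no; move/eqP: x0; apply; apply: pi_ext => m n.
    by rewrite linear0; apply: contrapT => /eqP mn; apply: no; exists m, n.
  by exists (m + n)%N; apply/asboolP; exists m, n.
have [N xN] := pi_finite_support x.
have suppN s : supp s -> (s <= N)%N.
  move=> /asboolP[m [n [<- ]]]; apply: contraNT; rewrite -ltnNge => /ltnW/xN ->.
  by rewrite eqxx.
have [s /asboolP[m [n [mns mnx]]] smax] := ex_maxnP (ex_intro _ s0 s0x) suppN.
pose y := lact (counit \o pi m n) x.
have Dy : D y by have [] := cD x Dx (counit \o pi m n).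
have pi_y a c : pi a c y = comul_coef (a + m) (c + n) m n *:
    (pi (a + m) (c + n) x * (yp ^+ m * ym ^+ n)) by rewrite lact_coordinate lact_counit.
(* Any other coordinate of [y] comes from a coordinate of [x] of total degree above the maximum. *)
have y_range : y = i (pi 0 0 y).
  apply: pi_ext => a c; rewrite pi_i; case: ifP => [/andP[/eqP-> /eqP->]//|ac].
  rewrite pi_y; suff /eqP -> : pi (a + m) (c + n) x == 0 by rewrite mul0r scaler0.
  apply: contraFT ac => acx; have /smax : supp (a + m + (c + n))%N.
    by apply/asboolP; exists (a + m)%N, (c + n)%N.
  by rewrite -mns addnACA -{2}[(m + n)%N]add0n leq_add2r leqn0 addn_eq0.
(* The coefficient involves only the q-binomials (m, m) and (n, n), which are 1. *)
have y0 : y != 0.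
  apply: contra_neq mnx => y0; apply/eqP; rewrite -(mul_ypym_eq0 _ m n).
  have /esym/eqP := pi_y 0%N 0%N; rewrite y0 linear0 !add0n scaler_eq0 => /orP[|//].
  by apply: contraLR => _; rewrite comul_coef_neq0 !qbinomialnn oner_eq0.
have sR : subcoalgebra (range i).
  apply: subcoalgebra_image => //; apply/subcoalgebraP; split=> //.
have [||Di0|<-] := minD (D `&` range i).
- exact: subcoalgebraI.
- by move=> z [].
- have : (D `&` range i) y by split=> //; rewrite y_range; exists (pi 0 0 y).
  by rewrite Di0 => /eqP; rewrite (negPf y0).
- by move=> z [].
Qed.

Lemma coradical_ambiskew : coradical A = i @` coradical R.
Proof. exact: coradical_embedding comul_i iK simple_subcoalgebra_range. Qed.

Lemma pbw_filtration0 : coradical A = pbw_filtration 0.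
Proof.
have [zd _] := hat_compatible_order chark0 xi.
have hat_eq0 m : (hat xi m == 0%N) = (m == 0%N) := hat_of_eq0 m (hat_compatible_gt0 zd).
rewrite coradical_ambiskew; apply/seteqP; split=> [_ [r Cr <-]|x Fx].
  rewrite -monomial00; apply: pbw_filtration_monomial.
  by rewrite /shifted_filtration ifT // leqn0 addn_eq0 !hat_eq0.
exists (pi 0 0 x).
  have := Fx 0%N 0%N; rewrite /shifted_filtration ifT ?sub0n //.
  by rewrite leqn0 addn_eq0 !hat_eq0.
apply: pi_ext => m n; rewrite pi_i; case: ifP => [/andP[/eqP-> /eqP->]//|mn].
by have := Fx m n; rewrite /shifted_filtration leqn0 addn_eq0 !hat_eq0 mn => ->.
Qed.

(** * The induction step *)

(** A coordinate with hat sum a at most t + 1 is tested by [f \o pi 0 0] with [f] zero on R_0; one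
    with larger a is shown to vanish by [counit \o pi j l] with (j, l) nonzero. *)
Lemma pbw_filtration_sub t x :
  (forall g : {scalar A}, (forall y, coradical A y -> g y = 0) -> pbw_filtration t (lact g x)) ->
  pbw_filtration t.+1 x.
Proof.
have [zd zdV] := hat_compatible_order chark0 xi.
move=> Fx m n; set a := (_ + _)%N.
have step j l : (j <= m)%N -> (l <= n)%N -> (0 < j + l)%N -> comul_coef m n j l != 0 ->
    (t < hat xi (m - j) + hat xi (n - l))%N -> pi m n x = 0.
  move=> jm ln jl0 c0 tlt.
  have g0 y : coradical A y -> (counit \o pi j l) y = 0.
    rewrite coradical_ambiskew => -[r _ <-] /=; rewrite pi_i; case: ifP; last by rewrite linear0.
    by move=> /andP[/eqP j0 /eqP l0]; rewrite j0 l0 in jl0.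
  have := Fx _ g0 (m - j)%N (n - l)%N.
  rewrite lact_coordinate !subnK // lact_counit /shifted_filtration leqNgt tlt /= => /eqP.
  by rewrite scaler_eq0 (negPf c0) mul_ypym_eq0 => /eqP.
have zero (f : {scalar R}) : (forall y, coradical R y -> f y = 0) -> shifted_filtration t a (lact f (pi m n x)).
  move=> f0; have g0 y : coradical A y -> (f \o pi 0 0) y = 0.
    by rewrite coradical_ambiskew => -[r Cr <-] /=; rewrite iK; exact: f0.
  have := Fx _ g0 m n.
  by rewrite lact_coordinate !addn0 /comul_coef !qbinomial0 muln0 !expr0 !mulr1 scale1r.
rewrite /shifted_filtration; have [at1|ta] := leqP a t.+1.
  rewrite /shifted_filtration in zero.
  move: at1 zero; rewrite leq_eqVlt => /orP[/eqP->|]; rewrite ?ltnn.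
    (* For a = t + 1 the tests give 0 rather than membership in a level of R. *)
    by rewrite subnn => zero; exact: coradicalP.
  by rewrite ltnS => a_t; rewrite a_t subSn // => zero; apply/coradical_filtrationS.
(* Now a > t + 1, so lowering one hat by exactly 1 still leaves a sum above t. *)
have [m0|m0] := posnP m; last first.
  have [j [/andP[j0 jm] bj hj]] := exists_hat_of_pred chark0 zd m0.
  apply: (step j 0%N) => //; first by rewrite addn0.
    by rewrite comul_coef_neq0 bj qbinomial0 oner_eq0.
  by rewrite subn0 -ltnS -addSn /hat hj.
have [n0|n0] := posnP n.
  by move: ta; rewrite /a m0 n0 /hat !div0n !mod0n.
have [l [/andP[l0 ln] bl hl]] := exists_hat_of_pred chark0 zdV n0.
apply: (step 0%N l) => //.
  by rewrite comul_coef_neq0 bl qbinomial0 oner_eq0.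
by rewrite subn0 -ltnS -addnS /hat hl.
Qed.

(** In a term with (j, l) nonzero the hat sum drops, which makes up for the lost level. In the term
    (0, 0) the functional kills R_0, so the level drops in R. *)
Lemma lact_pbw_filtration t x (g : {scalar A}) :
  (forall y, coradical A y -> g y = 0) -> pbw_filtration t.+1 x -> pbw_filtration t (lact g x).
Proof.
have [zd zdV] := hat_compatible_order chark0 xi.
have sF := pbw_filtration_subspace t.
move=> g0 Fx; have [N ->] := pbw_sum x.
rewrite linear_sum; apply: subspace_sum => // m _.
rewrite linear_sum; apply: subspace_sum => // n _.
have := Fx m n; move: (pi m n x) => r Fr /=.
rewrite lact_monomial; apply: subspace_sum => // -[j jm] _; apply: subspace_sum => // -[l ln] _ /=.
have [->|] := eqVneq (comul_coef m n j l) 0; first by rewrite scale0r; exact: sF.1.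
rewrite comul_coef_neq0 => /andP[bj bl].
apply: (subspaceZ _ sF); apply/pbw_filtration_monomial/shifted_filtration_translate.
have lact0 f : shifted_filtration t (hat xi (m - j) + hat xi (n - l)) (lact f 0).
  by rewrite linear0; exact: (shifted_filtration_subspace _ _).1.
move: Fr; rewrite {1}/shifted_filtration; set a := (hat xi m + _)%N.
have [at1 Cr|_ ->//] := leqP a t.+1.
have [jl0|jl0] := posnP (j + l).
  move/eqP: jl0 lact0; rewrite addn_eq0 => /andP[/eqP-> /eqP->]; rewrite !subn0 -/a => lact0.
  have g00 y : coradical R y -> (g \o monomial 0 0) y = 0.
    move=> Cy /=; rewrite monomial00; apply: g0; rewrite coradical_ambiskew.
    by exists y.
  (* If a = t + 1, the coefficient lies in R_0 and is sent to 0. *)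
  move: at1 Cr; rewrite leq_eqVlt => /orP[/eqP aE|].
    by rewrite aE subnn => /(lact_coradical_eq0 g00) ->; exact: (shifted_filtration_subspace _ _).1.
  rewrite ltnS => a_t; rewrite subSn // => /coradical_filtrationS Cr.
  by rewrite /shifted_filtration a_t; exact: Cr.
have lt_a : (hat xi (m - j) + hat xi (n - l) < a)%N.
  have [j0|j0] := posnP j.
    move: jl0; rewrite j0 add0n subn0 => l0; rewrite ltn_add2l.
    by apply: (hat_of_sub_lt zdV) bl; rewrite l0 -ltnS.
  have hj : (hat xi (m - j) < hat xi m)%N by apply: (hat_of_sub_lt zd) bj; rewrite j0 -ltnS.
  have [->|l0] := posnP l; first by rewrite subn0 ltn_add2r.
  have hl : (hat xi (n - l) < hat xi n)%N by apply: (hat_of_sub_lt zdV) bl; rewrite l0 -ltnS.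
  by rewrite /a -addSn; apply: leq_add => //; exact: ltnW.
rewrite /shifted_filtration ifT; last by rewrite -ltnS (leq_trans lt_a).
apply: coradical_filtration_leq (lact_coradical_filtration _ Cr).
by rewrite leq_subCl; lia.
Qed.

Lemma coradical_filtration_ambiskew t : coradical_filtration A t = pbw_filtration t.
Proof.
elim: t => [|t IHt]; first exact: pbw_filtration0.
apply/seteqP; split=> x.
  by move=> /coradical_filtrationS; rewrite IHt; exact: pbw_filtration_sub.
by move=> Fx; apply/coradical_filtrationS => g g0; rewrite IHt; exact: lact_pbw_filtration.
Qed.

End AmbiskewHopf.

Theorem theorem5p3 (k : fieldType) (chark0 : [pchar k] =i pred0)
    (R A : hopfAlgType k)
    (sigma sigmaV : {lrmorphism R -> R})
    (sigmaK : cancel sigma sigmaV) (sigmaVK : cancel sigmaV sigma)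
    (h : R) (h_central : forall r : R, h * r = r * h)
    (xi : k) (xi_neq0 : xi != 0)
    (i : {lrmorphism R -> A}) (Xp Xm : A)
    (A_ambiskew : is_ambiskew sigma sigmaV h xi i Xp Xm)
    (A_extends : hopf_extension i)
    (yp ym : R) (yp_grouplike : grouplike yp) (ym_grouplike : grouplike ym)
    (comul_Xp : comul Xp = Xp \ox 1 + i yp \ox Xp)
    (comul_Xm : comul Xm = Xm \ox 1 + i ym \ox Xm)
    (t : nat) :
  coradical_filtration A t =
  lspan [set x : A | exists q m n : nat, exists r : R,
    [/\ (q + hat xi m + hat xi n <= t)%N,
        coradical_filtration R q r
      & x = i r * Xp ^+ m * Xm ^+ n]].
Proof.
have [comul_i _ _] := A_extends.
have [pi piE] := pbw_coordinates sigmaK sigmaVK h_central xi_neq0 A_ambiskew.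
rewrite -(pbw_filtrationE xi_neq0 A_ambiskew piE).
exact: (coradical_filtration_ambiskew sigmaK sigmaVK xi_neq0 A_ambiskew comul_i
  yp_grouplike ym_grouplike comul_Xp comul_Xm piE chark0).
Qed.
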